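(* Let $P$ be the Gaussian parity on Gauss diagrams on $\mathbb{R}$. For all $k\ge1$ and all $m_1,m_2\in\mathbb{N}$ with $m_1\ne m_2$, there exists a long virtual knot $K$ such that $c_{2k}[m_1](K)\neq c_{2k}[m_2](K)$. Hence $\nabla[m_1](K)\ne\nabla[m_2](K)$.
   Context: Gauss diagrams. A Gauss diagram (on $\mathbb{R}$) is the oriented line with finitely many arrows, each with a sign $\oplus=+1$ or $\ominus=-1$, all endpoints distinct, up to orientation-preserving homeomorphism. $C(D)$ is the set of arrows of $D$. An arrow is isolated if its endpoints are consecutive; two arrows are linked if their endpoints alternate. Reidemeister moves: $\Omega 1$ adds/removes an isolated arrow; $\Omega 2$ adds/removes two arrows of opposite sign whose tails are adjacent and whose heads are adjacent; $\Omega 3$: given three disjoint intervals $1,2,3$ (in any order) and three arrows of equal sign, $1\to2$, $1\to3$, $2\to3$, whose endpoints occur on interval 1 in the order $(12),(13)$, on interval 2 in the order $(12),(23)$, on interval 3 in the order $(13),(23)$ (no other endpoints there), the move reverses the order of the two endpoints on each interval (and the inverse move). Long virtual knots are the equivalence classes; $D_K$ is any Gauss diagram of $K$. Labels. Gaussian parity: an arrow is odd (even) if it is linked with an odd (even) number of arrows. $f(D)$ deletes all odd arrows of $D$. For $m\in\mathbb{N}\cup\{\infty\}$, with $\infty+1=\infty$, the $f^m$-label of $x\in C(D)$ is the least $i$, $1\le i\le m$, with $x\notin C(f^i(D))$, and $m+1$ if there is none. $\Lambda[m](D)$ is $D$ with its $f^m$-labelling; $I[m](D)=\sum_{F\subseteq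 D}F$ over all subdiagrams (subsets of arrows, keeping signs and labels). $\langle F,E\rangle$ is the bilinear pairing with $\langle D,E\rangle=\delta_{DE}$ on labelled diagrams. Conway formulas. Smoothing all arrows of a Gauss diagram on $\mathbb{R}$: a traveller arriving at an endpoint of an arrow (moving along the orientation of the line) jumps to the other endpoint of that arrow and continues from there along the orientation. The diagram has one component if the result is a single path from $-\infty$ to $\infty$ (no closed components); then each arrow is passed exactly twice. A one-component diagram is ascending if the first pass along each arrow is from its tail to its head. $C_{2n}$ is the sum of all ascending (one-component) signed Gauss diagrams with exactly $2n$ arrows, each weighted by the product of the signs of its arrows. $C^e_{2n}[m]$ is $C_{2n}$ with every arrow labelled $m+1$ ($\infty$ if $m=\infty$). $C^o_{2n}[m]$ is the sum of the diagrams obtained from summands of $C_{2n}$ (with the same weights) by labelling arrows by elements of $\{1,\dots,m+1\}$ in all possible ways such that not all labels equal $m+1$; $C^o_0[m]=0$. Define, for $m\in\mathbb{N}$, $$c_{2n}[m](K)=\langle C^e_{2n}[\infty],I[\infty]\circ\Lambda[\infty](D_K)\rangle+\langle C^o_{2n}[m],I[m]\circ\Lambda[m](D_K)\rangle,\qquad \nabla[m](K)=\sum_{n\ge0}c_{2n}[m](K)z^{2n}.$$ These are invariants of long virtual knots. *)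

(* Defs.v *)
From HB Require Import structures.
From mathcomp Require Import all_boot all_order all_algebra.
From Stdlib Require Import Relation_Operators.

Set Implicit Arguments.
Unset Strict Implicit.
Unset Printing Implicit Defensive.

Import GRing.Theory.

(* A Gauss diagram on the line is written as the word of its arrow endpoints,
   read along the orientation.  An endpoint carries the name of its arrow, a
   boolean (false at the tail, true at the head) and the decoration of its
   arrow: a sign, or a sign together with a label.  Names are immaterial: two
   words present the same diagram (up to orientation-preserving homeomorphism)
   when they differ by a renaming, see [iso] below. *)

Section Words.
Variable T : eqType.

Definition letter : Type := (nat * bool * T)%type.
Definition word : Type := seq letter.

Implicit Types (e : letter) (w : word).

Definition arrow e : nat := e.1.1.
Definition is_head e : bool := e.1.2.
Definition deco e : T := e.2.

Definition mirror e : letter := (arrow e, ~~ is_head e, deco e).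

(* Every arrow occurs exactly twice, as a tail and as a head, with the same
   decoration. *)
Definition is_gauss w : bool :=
  all (fun e => (count (fun d => arrow d == arrow e) w == 2)
                && (mirror e \in w)) w.

Definition arrows w : seq nat := undup (map arrow w).

Definition subdiagram (A : pred nat) w : word := [seq e <- w | A (arrow e)].

(* Canonical renaming of the arrows by 0, 1, ... *)
Definition normal w : word :=
  [seq (index (arrow e) (arrows w), is_head e, deco e) | e <- w].

Definition iso w1 w2 : bool := normal w1 == normal w2.

Definition linked w (x y : nat) : bool :=
  let s := [seq z <- map arrow w | (z == x) || (z == y)] in
  (x != y) && ((s == [:: x; y; x; y]) || (s == [:: y; x; y; x])).

End Words.

(** Smoothing of all arrows *)

Section Smoothing.
Variable T : eqType.
Implicit Type w : word T.

(* Position of the other endpoint of the arrow whose endpoint is at i. *)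
Definition partner w (i : nat) : nat :=
  find (fun j => (j != i) && (nth 0 (map (@arrow T) w) j
                              == nth 0 (map (@arrow T) w) i))
       (iota 0 (size w)).

(* The endpoints 0, ..., N-1 of w cut the line into the segments 0, ..., N;
   segment i, for i < N, ends at endpoint i and segment N ends at infinity.
   At the end of segment i the traveller jumps to the other endpoint of the
   arrow and continues on the segment starting there. *)
Definition next_segment w (i : nat) : nat :=
  if i < size w then (partner w i).+1 else i.

Definition walk w : seq nat := traject (next_segment w) 0 (size w).+1.

(* The path from -oo to +oo runs through every segment, so there is no closed
   component. *)
Definition one_component w : bool := perm_eq (walk w) (iota 0 (size w).+1).

(* In the walk, i stands for the arrival at endpoint i, so for each tail e the
   arrival at e has to precede the arrival at the corresponding head. *)
Definition ascending w : bool :=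
  all (fun e => is_head e || (index (index e w) (walk w)
                              < index (index (mirror e) w) (walk w))) w.

End Smoothing.

(** Gauss diagrams, Reidemeister moves and long virtual knots *)

(* true stands for the sign +1. *)
Definition sgn (s : bool) : int := (if s then 1 else -1)%R.

Record gauss_diagram := GaussDiagram {
  code :> word bool;
  code_gauss : is_gauss code }.

Inductive omega1 : word bool -> word bool -> Prop :=
| Omega1 u0 u1 e : omega1 (u0 ++ u1) (u0 ++ [:: e; mirror e] ++ u1).

Inductive omega2 : word bool -> word bool -> Prop :=
| Omega2 u0 u1 u2 B1 B2 (x y : nat) (h s : bool) :
    perm_eq B1 [:: (x, h, s); (y, h, ~~ s)] ->
    perm_eq B2 [:: (x, ~~ h, s); (y, ~~ h, ~~ s)] ->
    omega2 (u0 ++ u1 ++ u2) (u0 ++ B1 ++ u1 ++ B2 ++ u2).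

(* The arrows a, b, c are 1 -> 2, 1 -> 3 and 2 -> 3. *)
Inductive omega3 : word bool -> word bool -> Prop :=
| Omega3 u0 u1 u2 u3 B1 B2 B3 (a b c : nat) (s : bool) :
    perm_eq [:: B1; B2; B3] [:: [:: (a, false, s); (b, false, s)];
                                [:: (a, true, s); (c, false, s)];
                                [:: (b, true, s); (c, true, s)]] ->
    omega3 (u0 ++ B1 ++ u1 ++ B2 ++ u2 ++ B3 ++ u3)
           (u0 ++ rev B1 ++ u1 ++ rev B2 ++ u2 ++ rev B3 ++ u3).

Definition elementary (D E : gauss_diagram) : Prop :=
  [\/ iso D E, omega1 D E, omega2 D E | omega3 D E].

Definition equivalent : gauss_diagram -> gauss_diagram -> Prop :=
  clos_refl_sym_trans gauss_diagram elementary.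

(* A long virtual knot is an equivalence class; [represents K D] says that D is
   a Gauss diagram of K. *)
Record long_virtual_knot := LongVirtualKnot {
  represents :> gauss_diagram -> Prop;
  knot_class : exists D0, forall D, represents D <-> equivalent D0 D }.

(** Gaussian parity and labels *)

Definition odd_arrow (w : word bool) (x : nat) : bool :=
  odd (count (linked w x) (arrows w)).

Definition delete_odd (w : word bool) : word bool :=
  subdiagram (fun x => ~~ odd_arrow w x) w.

(* Elements of {0, 1, ...} \cup {oo}, with None as oo; oo + 1 = oo is
   [omap succn]. *)
Definition enat : eqType := option nat.

(* The f^m-label.  For m = oo it suffices to search up to the number of arrows
   of w, as the iterates of f are constant from there on ([iter_delete_odd]). *)
Definition flabel (m : enat) (w : word bool) (x : nat) : enat :=
  let bound := if m is Some m' then m' else size (arrows w) in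
  head (omap succn m)
    [seq Some i | i <- iota 1 bound & x \notin arrows (iter i delete_odd w)].

Definition labelled : eqType := (bool * enat)%type.

Definition put_labels (g : nat -> enat) (w : word bool) : word labelled :=
  [seq (arrow e, is_head e, (deco e, g (arrow e))) | e <- w].

Definition Lambda (m : enat) (w : word bool) : word labelled :=
  put_labels (flabel m w) w.

(** Formal sums of labelled diagrams *)

(* A formal integer combination is given by the list of its weighted terms;
   repeated terms add up. *)
Definition formal_sum : Type := seq (int * word labelled).

Local Open Scope ring_scope.

Definition pairing (F E : formal_sum) : int :=
  \sum_(a <- F) \sum_(b <- E) a.1 * b.1 * (iso a.2 b.2)%:R.

(* The sum of all subdiagrams: one term for each subset of the arrows. *)
Definition I_sum (L : word labelled) : formal_sum :=
  [seq (1, subdiagram (mem (mask t (arrows L))) L)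
     | t : (size (arrows L)).-tuple bool].

(** The Conway formulas *)

(* All signed diagrams with exactly N arrows, once up to isomorphism. *)
Definition signed_diagrams (N : nat) : seq (word bool) :=
  [seq w <- [seq [seq (val e.1.1, e.1.2, e.2) | e <- tval t]
               | t : (N.*2).-tuple ('I_N * bool * bool)]
     | is_gauss w && (normal w == w)].

Definition weight (w : word bool) : int :=
  \prod_(e <- w | is_head e) sgn (deco e).

(* The summands of C_N; each has weight [weight w]. *)
Definition conway_diagrams (N : nat) : seq (word bool) :=
  [seq w <- signed_diagrams N | one_component w && ascending w].

Definition C_even (N : nat) (m : enat) : formal_sum :=
  [seq (weight w, put_labels (fun=> omap succn m) w) | w <- conway_diagrams N].

(* The element j of 'I_m.+1 encodes the label j.+1. *)
Definition odd_labellings (N m : nat) : seq {ffun 'I_N -> 'I_m.+1} :=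
  [seq g : {ffun 'I_N -> 'I_m.+1} <- enum predT
     | ~~ [forall i, g i == ord_max]].

(* The arrows of a summand of C_N are named 0, ..., N-1. *)
Definition label_of (N m : nat) (g : {ffun 'I_N -> 'I_m.+1}) (x : nat) : enat :=
  omap (fun i => (nat_of_ord (g i)).+1) (insub x).

Definition C_odd (N m : nat) : formal_sum :=
  [seq (weight w, put_labels (label_of g) w)
     | w <- conway_diagrams N, g <- odd_labellings N m].

(* c_{2n}[m], computed on a given diagram. *)
Definition conway_coef (n m : nat) (D : gauss_diagram) : int :=
  pairing (C_even n.*2 None) (I_sum (Lambda None D))
  + pairing (C_odd n.*2 m) (I_sum (Lambda (Some m) D)).

(* The coefficients c_{2n}[m] with n > size (code D) vanish, see [coef_nabla]. *)
Definition nabla (m : nat) (D : gauss_diagram) : {poly int} :=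
  \sum_(n < (size (code D)).+1) (conway_coef n m D)%:P * 'X^(n.*2).

Lemma size_delete_odd (w : word bool) (i : nat) :
  (size (arrows (iter i delete_odd w)) <= size (arrows w) - i)%N
  \/ delete_odd (iter i delete_odd w) = iter i delete_odd w.
Proof.
elim: i => [|i [IH|IH]]; [by left; rewrite subn0 | | by right; rewrite iterS !IH].
rewrite iterS; set v := iter i _ _ in IH *.
have [/all_filterP E|/allPn[e ev oe]] :=
  boolP (all (fun e => ~~ odd_arrow v (arrow e)) v).
  by right; rewrite /delete_odd /subdiagram !E.
left; rewrite subnS -ltnS; apply: (@leq_trans (size (arrows v))); last first.
  case: (size (arrows w) - i)%N IH => [|k] //=; rewrite leqn0 => /eqP/size0nil E.
  by have := map_f (@arrow _) ev; rewrite -mem_undup -/(arrows v) E.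
have sub1 : {subset arrow e :: arrows (delete_odd v) <= arrows v}.
  move=> x; rewrite inE => /orP[/eqP->|].
    by rewrite mem_undup map_f.
  rewrite !mem_undup => /mapP[d]; rewrite mem_filter => /andP[_ dv] ->.
  exact: map_f.
have := uniq_leq_size _ sub1; apply; rewrite /= undup_uniq andbT mem_undup.
apply/mapP=> -[d]; rewrite mem_filter => /andP[od _] E.
by move: oe; rewrite E od.
Qed.

Lemma iter_delete_odd (w : word bool) (i : nat) : (size (arrows w) <= i)%N ->
  iter i delete_odd w = iter (size (arrows w)) delete_odd w.
Proof.
move=> /subnK <-; elim: (i - _)%N => [//|k IH]; rewrite addSn iterS IH.
have [|//] := size_delete_odd w (size (arrows w)).
set v := iter _ _ _; rewrite subnn leqn0 => /eqP/size0nil/undup_nil.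
by case: v.
Qed.

Lemma coef_nabla (m : nat) (D : gauss_diagram) (n : nat) :
  (nabla m D)`_(n.*2) = conway_coef n m D.
Proof.
have vanish : (size (code D) < n)%N -> conway_coef n m D = 0.
  move=> ltDn.
  have size_conway w : w \in conway_diagrams n.*2 -> size w = n.*2.*2.
    rewrite !mem_filter => /andP[_ /andP[_ /mapP[t _ ->]]].
    by rewrite size_map size_tuple.
  have pair0 (F : formal_sum) k : (forall a, a \in F -> size a.2 = n.*2.*2) ->
      pairing F (I_sum (Lambda k D)) = 0.
    move=> sF; rewrite /pairing big_seq big1 // => a aF.
    rewrite big_seq big1 // => b /mapP[t _ ->] /=.
    rewrite /iso; case: eqP => [/(congr1 size)|]; last by rewrite mulr0.
    rewrite !size_map sF // => E.
    have : (n.*2.*2 <= size (code D))%N.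
      rewrite E size_filter (leq_trans (count_size _ _)) // size_map //.
    by rewrite leqNgt (leq_trans ltDn) // -!addnn -addnA leq_addr.
  rewrite /conway_coef !pair0 ?addr0 // => a.
    by case/allpairsP=> -[w g] [/= wC _ ->]; rewrite size_map size_conway.
  by case/mapP=> w wC ->; rewrite size_map size_conway.
rewrite /nabla coef_sum.
under eq_bigr => i _ do rewrite coefCM coefXn (inj_eq double_inj).
have [ltDn|leDn] := ltnP (size (code D)) n.
  rewrite vanish // big1 // => i _.
  by rewrite gtn_eqF ?mulr0 // (leq_trans (ltn_ord i)).
rewrite (bigD1 (Ordinal (leDn : (n < (size (code D)).+1)%N))) //= eqxx mulr1.
rewrite big1 ?addr0 // => i ni; case: eqP => [E|_]; last by rewrite mulr0.
by case/eqP: ni; apply: val_inj.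
Qed.

(* Main.v *)
Require Import Defs.
From mathcomp Require Import all_boot all_order all_algebra.
From mathcomp Require Import zify ring.

Set Implicit Arguments.
Unset Strict Implicit.
Unset Printing Implicit Defensive.

Import GRing.Theory.

(** Write [f] for the deletion of odd arrows and, for an unlabelled diagram [w],
    [coef N w] for the signed number of ascending one-component subdiagrams of
    [w] with [N] arrows.  An arrow has label [m + 1] exactly when it survives in
    [f^m w], so sorting subdiagrams by their labels gives
      c_{2n}[m](D) = coef (f^oo D) + coef D - coef (f^m D)
    ([conway_coefE]): the dependence on [m] sits in the last term alone.

    The right-hand side depends only on the knot because [coef] is invariant
    under the moves ([move_coef]) and [f] sends a move to a move or to an
    equality ([move_delete_odd]).  For the latter, an arrow is odd exactly when
    the positions of its two endpoints have the same parity ([odd_arrowE]), so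
    that parities can be followed through the moves by counting letters.

    For the former, a one-component diagram is described by the list of endpoints
    that the traveller meets ([conwayP]), and the central tool [tour_subst]
    compares such lists: if a traveller enters some intervals of the line, a
    filling of the intervals only matters through the way in which it connects
    them and through the endpoints passed inside.  A subdiagram containing an
    isolated arrow, or both arrows of an Omega2 move, is never an ascending
    one-component diagram, and the subdiagrams containing exactly one of the two
    arrows cancel in pairs.  In an Omega3 move the subdiagrams with at most one
    of the three arrows are not changed at all.  With two of them, smoothing
    connects the three intervals cyclically; for either cyclic order, the tours
    that are ascending for one of two choices of the pair before (after) the
    move are those that are ascending for the third pair after (before) it
    ([fill_forward], [fill_backward]).  With all three arrows, the two sides of
    the move correspond to each other ([fill_full]).

    Finally the values are separated.  A chain of [k] clasps is an ascending
    one-component diagram with [2k] arrows, all odd.  Every diagram is [f w'] for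
    some [w'], obtained by surrounding one endpoint of every odd arrow by a new
    arrow ([delete_odd_surj]).  So for [m1 < m2] some [D] has [f^m1 D] equal to
    the chain, with [coef] equal to 1, and [f^m2 D] empty, with [coef] 0. *)

(** * Gauss words *)

Section GaussWords.
Variable T : eqType.
Implicit Types (e d : letter T) (w u v p : word T).

Lemma arrow_mirror e : arrow (mirror e) = arrow e. Proof. by []. Qed.

Lemma mirrorK : involutive (@mirror T).
Proof. by case=> [[x h] t]; rewrite /mirror /= negbK. Qed.

Lemma mirror_neq e : (mirror e == e) = false.
Proof. by case: e => [[x []] t]; apply/eqP => -[]. Qed.

Lemma mirror_inj : injective (@mirror T).
Proof. exact: inv_inj mirrorK. Qed.

(** In a Gauss word the letters are distinct and each arrow consists of a letter
    and its mirror image; this form is stable under permutation of the word. *)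
Lemma gaussP w : reflect
  [/\ uniq w, {in w, forall e, mirror e \in w}
    & {in w &, forall d e, arrow d = arrow e -> d = e \/ d = mirror e}]
  (is_gauss w).
Proof.
pose ends e := fun d => arrow d == arrow e.
apply: (iffP idP) => [/allP gw | [uw mw iw]].
- have sub2 e : e \in w -> {subset [:: e; mirror e] <= filter (ends e) w}.
    move=> ew d; rewrite !inE mem_filter.
    case/andP: (gw _ ew) => _ mw /orP[]/eqP->; by rewrite /ends eqxx ?ew ?mw.
  have u2 e : uniq [:: e; mirror e] by rewrite /= inE eq_sym mirror_neq.
  have sz e : e \in w -> size (filter (ends e) w) <= size [:: e; mirror e].
    by move=> ew; rewrite size_filter; case/andP: (gw _ ew) => /eqP->.
  have fE e (ew : e \in w) := uniq_min_size (u2 e) (sub2 e ew) (sz e ew).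
  split=> [|e ew|d e dw ew de].
  + apply: count_mem_uniq => e; case: (boolP (e \in w)) => ew; last first.
      by apply/count_memPn.
    have uf : uniq (filter (ends e) w).
      by case: (fE e ew) => E F; rewrite -(eq_uniq E F) u2.
    have /count_uniq_mem := uf => /(_ e).
    rewrite mem_filter /ends eqxx ew /= => <-.
    by rewrite count_filter; apply: eq_count => d /=; case: eqP => // ->; rewrite eqxx.
  + by case/andP: (gw _ ew).
  + have [_ F] := fE e ew.
    have : d \in [:: e; mirror e] by rewrite F mem_filter /ends de eqxx dw.
    by rewrite !inE => /orP[]/eqP; auto.
- apply/allP => e ew; rewrite mw // andbT.
  rewrite -size_filter -[2]/(size [:: e; mirror e]).
  apply/eqP/perm_size/uniq_perm; rewrite ?filter_uniq //=.
    by rewrite inE eq_sym mirror_neq.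
  move=> d; rewrite !inE mem_filter; apply/andP/orP => [[/eqP de dw]|].
    by case: (iw d e) => // ->; rewrite eqxx; auto.
  by case=> /eqP->; rewrite eqxx ?mw ?ew.
Qed.

Lemma perm_gauss w v : perm_eq w v -> is_gauss w = is_gauss v.
Proof.
move=> wv; rewrite /is_gauss (perm_all _ wv); apply: eq_all => e.
by rewrite (perm_mem wv) (permP wv).
Qed.

Lemma gauss_subdiagram (A : pred nat) w : is_gauss w -> is_gauss (subdiagram A w).
Proof.
case/gaussP=> uw mw iw; apply/gaussP; split; first by rewrite filter_uniq.
  by move=> e; rewrite !mem_filter => /andP[Ae ew]; rewrite arrow_mirror Ae mw.
by move=> d e; rewrite !mem_filter => /andP[_ dw] /andP[_ ew]; apply: iw.
Qed.

Lemma mem_arrows x w : (x \in arrows w) = (x \in map (@arrow T) w).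
Proof. exact: mem_undup. Qed.

Lemma arrows_mem e w : e \in w -> arrow e \in arrows w.
Proof. by move=> ew; rewrite mem_arrows map_f. Qed.

Lemma uniq_arrows w : uniq (arrows w). Proof. exact: undup_uniq. Qed.

Lemma mem_arrows_subdiagram (A : pred nat) w x :
  (x \in arrows (subdiagram A w)) = A x && (x \in arrows w).
Proof.
rewrite !mem_arrows; apply/mapP/andP => [[e]|[Ax /mapP[e ew xE]]].
  by rewrite mem_filter => /andP[Ae ew] ->; rewrite map_f.
by exists e; rewrite // mem_filter -xE Ax.
Qed.

Lemma subdiagram_cat (A : pred nat) u v :
  subdiagram A (u ++ v) = subdiagram A u ++ subdiagram A v.
Proof. exact: filter_cat. Qed.

Lemma eq_subdiagram_in (A B : pred nat) w :
  {in arrows w, A =1 B} -> subdiagram A w = subdiagram B w.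
Proof. by move=> AB; apply: eq_in_filter => e /arrows_mem /AB. Qed.

Lemma subdiagram_comp (A B : pred nat) w :
  subdiagram A (subdiagram B w) = subdiagram (predI A B) w.
Proof. by rewrite /subdiagram -filter_predI. Qed.

Lemma perm_arrows w (s : seq nat) :
  uniq s -> s =i map (@arrow T) w -> perm_eq (arrows w) s.
Proof.
by move=> us sw; apply: uniq_perm => // [|x]; rewrite ?undup_uniq // mem_arrows sw.
Qed.

Lemma gauss_count w x :
  is_gauss w -> x \in arrows w -> count_mem x (map (@arrow T) w) = 2.
Proof.
move=> /allP gw; rewrite mem_arrows => /mapP[e /gw/andP[/eqP ew _] ->].
by rewrite count_map -[RHS]ew; apply: eq_count => d.
Qed.

Lemma size_count (s t : seq nat) : uniq s -> {subset t <= s} ->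
  size t = \sum_(x <- s) count_mem x t.
Proof.
move=> us; elim: t => [|y t IH] ts /=; first by rewrite big1.
rewrite big_split /= -IH; last by move=> z zt; apply: ts; rewrite inE zt orbT.
rewrite (bigD1_seq y) ?ts ?mem_head //= eqxx big1 // => z.
by rewrite eq_sym => /negbTE->.
Qed.

Lemma size_gauss w : is_gauss w -> size w = (size (arrows w)).*2.
Proof.
move=> gw; rewrite -(size_map (@arrow T)).
rewrite (size_count (uniq_arrows w)); last by move=> x; rewrite mem_arrows.
rewrite -mul2n -count_predT -sum1_count big_distrr /=.
by apply: eq_big_seq => x /(gauss_count gw)->; rewrite muln1.
Qed.

End GaussWords.

(** * Trails through a word *)

Lemma onth_mem (X : eqType) (w : seq X) n x : onth w n = Some x -> x \in w.
Proof.
elim: w n => [|y s IH] [|n] //=; first by case=> ->; rewrite mem_head.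
by move/IH; rewrite inE orbC => ->.
Qed.

Lemma onth_index (X : eqType) (w : seq X) n y :
  uniq w -> onth w n = Some y -> index y w = n.
Proof.
elim: w n => [|z s IH] [|n] //= /andP[zs us]; first by case=> ->; rewrite eqxx.
move=> sn; rewrite (IH n us sn); case: eqP zs => // ->.
by rewrite (onth_mem sn).
Qed.

Lemma index_onth (X : eqType) (w : seq X) x : x \in w -> onth w (index x w) = Some x.
Proof. by elim: w => [|y w IH] //=; rewrite inE eq_sym; case: eqP => [->|_ /IH]. Qed.

Section Trails.
Variables (X : eqType) (mu : X -> X) (w : seq X).

Definition after (x : X) : option X := onth w (index (mu x) w).+1.

(** The traveller is about to arrive at [o], where [None] is the end of the
    line, and meets the letters of [p] in this order before the end.  The jump
    [mu] need not be an involution, so that a letter can also stand for a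
    whole interval that is entered here and left elsewhere. *)
Fixpoint trail (o : option X) (p : seq X) : bool :=
  if p is x :: p' then (o == Some x) && trail (after x) p' else o == None.

Definition tour (p : seq X) : bool := trail (onth w 0) p && perm_eq p w.

Lemma trail_uniq o p q : trail o p -> trail o q -> p = q.
Proof.
elim: p o q => [|x p IH] o [|y q] //=.
- by move/eqP->.
- by case/andP=> /eqP->.
by case/andP=> /eqP-> xp /andP[/eqP[<-] xq]; rewrite (IH _ _ xp xq).
Qed.

Lemma trail_cat o p x q : trail o (p ++ x :: q) ->
  (if p is z :: p' then after (last z p') else o) = Some x /\ trail (after x) q.
Proof.
elim: p o => [|y p IH] o /=; first by case/andP=> /eqP.
by case/andP=> _ /IH[+ xq]; case: p {IH}.
Qed.

Lemma trail_subset n p : trail (onth w n) p -> {subset p <= w}.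
Proof.
elim: p n => [|x p IH] n //= /andP[/eqP nx xp] y; rewrite inE => /predU1P[->|].
  exact: onth_mem nx.
exact: IH xp y.
Qed.

Hypothesis uw : uniq w.

Lemma after_split x l r : w = l ++ mu x :: r -> after x = ohead r.
Proof.
move=> E; have lx : mu x \notin l.
  by move: uw; rewrite E cat_uniq /= => /and3P[_ /norP[]].
have ix : index (mu x) w = size l by rewrite E index_cat (negbTE lx) index_head addn0.
by rewrite /after ix E -cat_rcons onth_cat size_rcons ltnn subnn; case: r {E}.
Qed.

(** Closed components are detected in this way: their letters can only be
    reached from each other. *)
Lemma trail_avoid (C : pred X) o p : trail o p ->
  oapp (predC C) true o ->
  (forall x y, after x = Some y -> C y -> C x) -> {in p, forall x, ~~ C x}.
Proof.
move=> + + closed; elim: p o => [//|x p IH] o /= /andP[/eqP-> xp] Cx y.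
rewrite inE => /predU1P[->//|]; apply: (IH _ xp).
by case E: (after x) => [z|] //; apply: contra Cx; apply: closed E.
Qed.

Lemma after_inj x z y : injective mu ->
  after x = Some y -> after z = Some y -> x = z.
Proof.
move=> mui xy zy; apply: mui.
have mem t : after t = Some y -> mu t \in w.
  rewrite /after -index_mem => E; rewrite ltnNge; apply/negP => L.
  by have := onth_index uw E; have := onth_mem E; rewrite -index_mem; lia.
apply: (index_inj x (mem x xy) (mem z zy)).
by apply: succn_inj; rewrite -(onth_index uw xy) -(onth_index uw zy).
Qed.

Lemma trail_pred o p x y : injective mu -> trail o p -> uniq p ->
  after x = Some y -> o != Some y -> y \in p -> index y p = (index x p).+1.
Proof.
move=> mui tp up xy oy yp.
case/splitPr: yp tp up => [p1 p2] /trail_cat[].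
case: p1 => [oE|z p1 zy _]; first by rewrite oE eqxx in oy.
have <- : last z p1 = x by apply: after_inj zy xy.
rewrite lastI; set l := last _ _; rewrite -cats1 -catA /= => up.
move: up; rewrite cat_uniq /= !inE => /and5P[_ /norP[lb /norP[yb _]] /norP[ly _] _ _].
by rewrite !index_cat (negbTE lb) (negbTE yb) /= !eqxx (negbTE ly) addn0 addn1.
Qed.

End Trails.

(** * Substituting blocks for letters *)

Lemma mem_split (T : eqType) (x : T) s :
  x \in s -> exists s1 s2, s = s1 ++ x :: s2.
Proof. by case/splitPr=> s1 s2; exists s1, s2. Qed.

Section Substitution.
Variables (X Y : eqType) (mu : X -> X) (nu : Y -> Y).
Variables (U : seq X) (B I : X -> seq Y).
Let W := flatten (map B U).

(** Inside the blocks the traveller runs from [y] through the letters of [s]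
    and then jumps to the last letter of the block [B z]. *)
Fixpoint threads (z : X) (y : Y) (s : seq Y) : Prop :=
  if s is y' :: s' then
    (exists x l r, x \in U /\ B x = l ++ nu y :: y' :: r) /\ threads z y' s'
  else exists l, B z = rcons l (nu y).

(** A traveller entering the block [B x] runs through [I x] and leaves at the
    end of the block [B (mu x)]. *)
Definition crossing (x : X) : Prop :=
  mu x \in U /\ exists y s t, [/\ B x = y :: t, I x = y :: s & threads (mu x) y s].

Hypotheses (uU : uniq U) (uW : uniq W).
Hypothesis crossU : {in U, forall x, crossing x}.

Let entry (o : option X) : option Y := obind (fun x => ohead (B x)) o.

Let after_inside x l y y' r :
  x \in U -> B x = l ++ nu y :: y' :: r -> after nu W y = Some y'.
Proof.
move=> xU Bx; have [U1 [U2 E]] := mem_split xU.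
rewrite (@after_split _ nu W uW y (flatten (map B U1) ++ l)
          (y' :: r ++ flatten (map B U2))) //.
by rewrite /W E map_cat flatten_cat /= Bx -!catA.
Qed.

(* Leaving at the end of [B (mu x)], the traveller arrives at the block that
   follows [mu x] in [U]; blocks are not empty. *)
Let after_exit x l y :
  x \in U -> B (mu x) = rcons l (nu y) -> after nu W y = entry (after mu U x).
Proof.
move=> xU Bx; have [muU _] := crossU xU; have [U1 [U2 E]] := mem_split muU.
rewrite (after_split uU E).
rewrite (@after_split _ nu W uW y (flatten (map B U1) ++ l) (flatten (map B U2))).
  case: U2 E => [|z U2] //= E.
  have zU : z \in U by rewrite E mem_cat !inE eqxx !orbT.
  by have [_ [? [? [? [-> _ _]]]]] := crossU zU.
by rewrite /W E map_cat flatten_cat /= Bx cat_rcons -catA.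
Qed.

Let threads_trail x y s p : x \in U -> threads (mu x) y s ->
  trail nu W (Some y) p
  <-> exists2 p', p = y :: s ++ p' & trail nu W (entry (after mu U x)) p'.
Proof.
move=> xU; elim: s y p => [|y' s IH] y p /=.
  case=> l /(after_exit xU) <-; split.
    by case: p => [|z p] //= /andP[/eqP[<-] yp]; exists p.
  by case=> p' -> /=; rewrite eqxx.
case=> -[z [l [r [zU /(after_inside zU) yy']]]] th.
have {}IH p' := IH y' p' th; split.
  case: p => [|t p] //= /andP[/eqP[<-]]; rewrite yy' => yp; have [p' -> tp'] := proj1 (IH p) yp.
  by exists p'.
case=> p' -> tp'.
suff H : trail nu W (Some y') (y' :: s ++ p') by apply/andP; rewrite eqxx yy'.
by apply: (proj2 (IH _)); exists p'.
Qed.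

(** The trails of the substituted word are the substituted trails: the blocks
    act on the traveller as the jumps [mu] do. *)
Lemma trail_subst o p : oapp (mem U) true o ->
  trail nu W (entry o) p
  <-> exists2 q, p = flatten (map I q) & trail mu U o q.
Proof.
have aU x : oapp (mem U) true (after mu U x).
  by case E: (after mu U x) => [z|] //; apply: onth_mem E.
have [n] := ubnP (size p); elim: n o p => // n IH [x|] p /ltnSE sp; last first.
  move=> _ /=; split; first by case: p sp => // _ _; exists [::].
  by case=> -[|x q] // ->.
move=> xU; have [_ [y [s [t [Bx Ix th]]]]] := crossU xU.
rewrite /= Bx; split.
  case/(threads_trail _ xU th)=> p' pE tp'.
  have ltp : size p' < n by move: sp; rewrite pE /= size_cat; lia.
  have [q p'E tq] := proj1 (IH _ p' ltp (aU x)) tp'.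
  by exists (x :: q); rewrite /= ?eqxx // Ix pE p'E.
case=> -[|z q] //= pE /andP[/eqP[zx] tq].
apply/(threads_trail _ xU th); exists (flatten (map I q)); first by rewrite pE -zx Ix.
apply: (proj2 (IH _ _ _ (aU x))); last by exists q; rewrite // zx.
by move: sp; rewrite pE -zx Ix /= size_cat; lia.
Qed.

(** The runs through the blocks miss no letter, so that no closed component
    is hidden inside the blocks. *)
Hypothesis permIB : perm_eq (flatten (map I U)) W.

Let block_disjoint x x' y : x \in U -> x' \in U -> y \in I x -> y \in I x' -> x = x'.
Proof.
move=> xU x'U yx yx'; have := uW; rewrite -(perm_uniq permIB).
have [U1 [U2 E]] := mem_split xU; move: x'U; rewrite E.
rewrite map_cat flatten_cat /= mem_cat inE => /or3P[x'U|/eqP->//|x'U].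
  rewrite cat_uniq => /and3P[_ /hasPn/(_ y)]; rewrite mem_cat yx => /(_ isT)/negP[].
  by apply/flattenP; exists (I x'); rewrite ?map_f.
rewrite cat_uniq => /and3P[_ _]; rewrite cat_uniq => /and3P[_ /hasPn/(_ y)].
have -> : y \in flatten (map I U2) by apply/flattenP; exists (I x'); rewrite ?map_f.
by move/(_ isT)/negP.
Qed.

(** Tours correspond as well: since the runs are disjoint and not empty, the
    letters of a trail tell which blocks it has entered. *)
Lemma tour_subst p :
  tour nu W p <-> exists2 q, p = flatten (map I q) & tour mu U q.
Proof.
have E0 : onth W 0 = entry (onth U 0).
  rewrite /W; case: (U) crossU => [|x V] //= H.
  by have [_ [y [s [t [-> _ _]]]]] := H x (mem_head _ _).
have oU : oapp (mem U) true (onth U 0).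
  by case: (U) => [|x V] //=; rewrite mem_head.
rewrite /tour E0; split; last first.
  case=> q -> /andP[tq qU]; apply/andP; split; first by apply/trail_subst => //; exists q.
  by apply: perm_trans permIB; apply/perm_flatten/perm_map.
case/andP=> /trail_subst[//|q -> tq] pW; exists q; rewrite // tq /=.
have sqU := trail_subset tq.
have uq : uniq q.
  have : uniq (flatten (map I q)) by rewrite (perm_uniq pW).
  elim: q sqU {tq pW} => [|x q IH] //= sxq.
  rewrite cat_uniq => /and3P[_ /hasPn dx /IH->]; last first.
    by move=> z zq; apply: sxq; rewrite inE zq orbT.
  rewrite andbT; apply/negP => xq.
  have [_ [y [s [t [_ Ix _]]]]] := crossU (sxq x (mem_head _ _)).
  have /dx/negP[] : y \in flatten (map I q).
    by apply/flattenP; exists (I x); rewrite ?map_f // Ix mem_head.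
  by rewrite Ix mem_head.
apply: uniq_perm => // x; apply/idP/idP => [/sqU//|xU].
have [_ [y [s [t [_ Ix _]]]]] := crossU xU.
have : y \in flatten (map I q).
  rewrite (perm_mem pW) -(perm_mem permIB); apply/flattenP.
  by exists (I x); rewrite ?map_f // Ix mem_head.
case/flattenP=> _ /mapP[x' x'q ->] yx'.
by rewrite (@block_disjoint x x' y) // ?sqU // Ix mem_head.
Qed.

End Substitution.

(** * Conway diagrams by their tours *)

Lemma onth_nth (X : Type) (x0 : X) s i x :
  onth s i = Some x -> i < size s /\ nth x0 s i = x.
Proof. by elim: s i => [|y s IH] [|i] //=; [case | move/IH]. Qed.

Lemma onth_None (X : Type) (s : seq X) i : onth s i = None -> size s <= i.
Proof. by elim: s i => [|y s IH] [|i] //= /IH. Qed.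

Lemma onth_ge (X : Type) (s : seq X) i : size s <= i -> onth s i = None.
Proof. by elim: s i => [|y s IH] [|i] //= /IH. Qed.

Section Conway.
Variable T : eqType.
Implicit Types (e d : letter T) (w u v p : word T).

Definition conway w : bool := one_component w && ascending w.

(** The two passes along the arrow of a tail [e] in [p] are at [e], then at
    [mirror e]. *)
Definition ascends p : bool :=
  all (fun e => is_head e || ([seq d <- p | arrow d == arrow e] == [:: e; mirror e])) p.

(** In a Gauss word the two letters of an arrow are the only ones that the filter
    keeps, so that only their order matters. *)
Lemma ascends_index p : is_gauss p ->
  ascends p = all (fun e => is_head e || (index e p < index (mirror e) p)) p.
Proof.
move=> gp; have [up mp ip] := gaussP _ gp; apply: eq_in_all => e ep.
congr (_ || _); have mep := mp e ep.
have [p1 [p2 E]] := mem_split ep.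
have e1 : e \notin p1 by move: up; rewrite E cat_uniq => /and3P[_ /norP[]].
have e2 : e \notin p2 by move: up; rewrite E cat_uniq /= => /and4P[].
have ide : index e p = size p1 by rewrite E index_cat (negbTE e1) index_head addn0.
have um1 : mirror e \in p1 -> mirror e \notin p2.
  move=> m1; move: up; rewrite E cat_uniq => /and3P[_ /norP[_ /hasPn np2] _].
  by apply/negP => /np2; rewrite /= m1.
have fil q : {subset q <= p} -> e \notin q ->
    mirror e \notin q -> [seq d <- q | arrow d == arrow e] = [::].
  move=> qp eq meq; apply/eqP; rewrite -(negbK (_ == _)) -has_filter; apply/hasPn.
  move=> d dq; apply/negP => /eqP/(ip _ _ (qp _ dq) ep)[] dE; move: dq; rewrite dE.
    by apply/negP.
  by apply/negP.
have sub1 : {subset p1 <= p} by move=> d dp; rewrite E mem_cat dp.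
have sub2 : {subset p2 <= p} by move=> d dp; rewrite E mem_cat inE dp !orbT.
rewrite ide E filter_cat /= eqxx index_cat.
case: (boolP (mirror e \in p1)) => m1.
  rewrite ltnNge (ltnW _) ?index_mem //=.
  rewrite (fil p2) ?um1 //; apply/eqP; case F: (filter _ p1) => [|d q].
    have : mirror e \in filter (fun d => arrow d == arrow e) p1.
      by rewrite mem_filter m1 arrow_mirror eqxx.
    by rewrite F.
  case=> dE _; have : d \in d :: q by rewrite mem_head.
  by rewrite -F mem_filter dE => /andP[_]; apply/negP.
rewrite (fil p1) //= [e == mirror e]eq_sym mirror_neq.
have m2 : mirror e \in p2 by move: mep; rewrite E mem_cat inE mirror_neq (negbTE m1).
have -> : size p1 < size p1 + (index (mirror e) p2).+1 by lia.
have [q1 [q2 E2]] := mem_split m2.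
have [n1 n2] : mirror e \notin q1 /\ mirror e \notin q2.
  have : uniq p2 by move: up; rewrite E cat_uniq /= => /and4P[].
  by rewrite E2 cat_uniq /= => /and4P[_ /norP[-> _] -> _].
have [n3 n4] : e \notin q1 /\ e \notin q2.
  by move: e2; rewrite E2 mem_cat inE => /norP[-> /norP[_ ->]].
rewrite E2 filter_cat /= eqxx !fil ?eqxx // => d dq; apply: sub2;
  by rewrite E2 mem_cat ?inE dq ?orbT.
Qed.

Lemma find_unique (P : pred nat) n k : k < n -> P k ->
  {in gtn n, forall j, P j -> j = k} -> find P (iota 0 n) = k.
Proof.
move=> kn Pk uk.
have hP : has P (iota 0 n) by apply/hasP; exists k; rewrite ?mem_iota.
have fn : find P (iota 0 n) < n by rewrite -[ltnRHS](size_iota 0) -has_find.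
by apply: uk => //; have := nth_find 0 hP; rewrite nth_iota.
Qed.

Lemma partnerE w i e : is_gauss w -> onth w i = Some e ->
  partner w i = index (mirror e) w.
Proof.
move=> gw wi; have [uw mw iw] := gaussP _ gw.
have [iN ei] := onth_nth e wi.
have ew : e \in w by rewrite -ei mem_nth.
have mN : index (mirror e) w < size w by rewrite index_mem mw.
have nE j : j < size w -> nth 0 (map (@arrow T) w) j = arrow (nth e w j).
  by move=> jN; rewrite (nth_map e).
apply: find_unique => //=.
  rewrite !nE // ei nth_index ?mw // arrow_mirror eqxx andbT.
  by apply: contraFneq (mirror_neq e) => E; rewrite -{2}ei -E nth_index ?mw.
move=> j jN /andP[ji]; rewrite !nE // ei => /eqP/(iw _ _ (mem_nth e jN) ew).
case=> E; last by rewrite -E index_uniq.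
by move: ji; rewrite -(index_uniq e jN uw) E -{1}ei index_uniq ?eqxx.
Qed.

Lemma next_segmentE w i e : is_gauss w -> onth w i = Some e ->
  next_segment w i = (index (mirror e) w).+1.
Proof.
move=> gw wi; rewrite /next_segment (partnerE gw wi).
by have [-> _] := onth_nth e wi.
Qed.

Lemma trail_traject w i p : is_gauss w -> i <= size w ->
  trail (@mirror T) w (onth w i) p ->
  traject (next_segment w) i (size p).+1 = rcons (map (index^~ w) p) (size w).
Proof.
move=> gw; have [uw mw _] := gaussP _ gw; elim: p i => [|e p IH] i iN.
  by move/eqP/onth_None => Ni /=; congr [:: _]; apply/eqP; rewrite eqn_leq iN.
case/andP=> /eqP wi ep; have ew := onth_mem wi.
rewrite trajectS map_cons rcons_cons (onth_index uw wi) (next_segmentE gw wi).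
by rewrite IH // index_mem mw.
Qed.

Lemma traject_trail w i n : is_gauss w -> i <= size w ->
  size w \in traject (next_segment w) i n ->
  exists2 p, size p < n & trail (@mirror T) w (onth w i) p.
Proof.
move=> gw; have [uw mw _] := gaussP _ gw; elim: n i => [|n IH] i iN //=.
rewrite inE => /predU1P[<-|]; first by exists [::]; rewrite //= onth_ge.
case wi: (onth w i) => [e|]; last by exists [::].
rewrite (next_segmentE gw wi) => /IH[|p pn tp].
  by rewrite index_mem mw // (onth_mem wi).
by exists (e :: p); rewrite //= eqxx.
Qed.

Lemma tour_gauss w p : is_gauss w -> tour (@mirror T) w p -> is_gauss p.
Proof. by move=> gw /andP[_ /perm_gauss->]. Qed.

(** The walk is constant once it has reached the last segment; being a
    permutation of the segments, it gets there at its very last step. *)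
Lemma one_componentP w : is_gauss w ->
  reflect (exists2 p, tour (@mirror T) w p & walk w = rcons (map (index^~ w) p) (size w))
          (one_component w).
Proof.
move=> gw; have [uw _ _] := gaussP _ gw.
apply: (iffP idP) => [|[p /andP[_ pw] wE]]; last first.
  rewrite /one_component wE -(addn1 (size w)) iotaD -cats1 perm_cat2r.
  apply: perm_trans (perm_map _ pw) _; apply: uniq_perm; rewrite ?iota_uniq //.
    by rewrite map_inj_in_uniq // => e d ew dw; apply: (index_inj e).
  move=> i; rewrite mem_iota /=; apply/mapP/idP => [[e ew ->]|iN].
    by rewrite index_mem.
  case: w iN uw {gw pw wE} => // e w iN uw.
  by exists (nth e (e :: w) i); rewrite ?mem_nth ?index_uniq.
rewrite /one_component => oc.
have Nw : size w \in walk w by rewrite (perm_mem oc) mem_iota /= ltnS.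
have [p pN tp] := traject_trail gw (leq0n _) Nw.
have tE := trail_traject gw (leq0n _) tp.
have {}pN : size p = size w.
  apply/eqP; rewrite eqn_leq -ltnS pN /= leqNgt; apply/negP => ltp.
  have uwalk : uniq (walk w) by rewrite (perm_uniq oc) iota_uniq.
  have swalk : size (walk w) = (size w).+1 by rewrite size_traject.
  have itp : iter (size p) (next_segment w) 0 = size w.
    by rewrite -(nth_traject _ (ltnSn (size p))) tE nth_rcons size_map ltnn eqxx.
  have wp : nth 0 (walk w) (size p) = size w by rewrite nth_traject ?itp // ltnS ltnW.
  have wp1 : nth 0 (walk w) (size p).+1 = size w.
    by rewrite nth_traject // iterS itp /next_segment ltnn.
  have := nth_uniq 0 (i := size p) (j := (size p).+1) _ _ uwalk.
  by rewrite swalk wp wp1 !ltnS ltp (ltnW ltp) eqxx ltn_eqF // => /(_ isT isT).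
rewrite pN in tE; exists p => //; rewrite /tour tp /=.
have : perm_eq (map (index^~ w) p) (iota 0 (size w)).
  by move: oc; rewrite /walk tE -[in iota _ _]addn1 iotaD -cats1 perm_cat2r.
move/(perm_map (fun i => onth w i)); rewrite -map_comp => pw.
have pE : map (onth w \o index^~ w) p = map Some p.
  apply/eq_in_map => e /(trail_subset tp) ew /=.
  exact: index_onth.
have wE : map (onth w) (iota 0 (size w)) = map Some w.
  by elim: (w) => //= e v <-; rewrite -(addn0 1) iotaDl -map_comp.
by move: pw; rewrite pE wE => /(perm_map_inj (@Some_inj _)).
Qed.

Lemma conwayP w : is_gauss w ->
  reflect (exists2 p, tour (@mirror T) w p & ascends p) (conway w).
Proof.
move=> gw; have [uw mw _] := gaussP _ gw.
have asc p : tour (@mirror T) w p -> walk w = rcons (map (index^~ w) p) (size w) ->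
    ascending w = ascends p.
  move=> tp wE; have /andP[_ pw] := tp.
  rewrite (ascends_index (tour_gauss gw tp)) (perm_all _ pw).
  have idx e : e \in w -> index (index e w) (walk w) = index e p.
    move=> ew; have ep : e \in p by rewrite (perm_mem pw).
    rewrite wE -cats1 index_cat (_ : _ \in _); last exact: map_f.
    have inw : {in w &, injective (index^~ w)} by exact: (index_inj e).
    have sub : {subset p <= w} by move=> d; rewrite (perm_mem pw).
    elim: p sub {tp wE pw} ep => [//|d p IH] sub ep /=.
    have dw := sub d (mem_head _ _).
    case: eqP => [/inw->//|/eqP]; rewrite ?eqxx //.
    rewrite (inj_in_eq inw) // => /negbTE de; rewrite de.
    move: ep; rewrite inE eq_sym de /= => ep; rewrite IH // => t tp.
    by apply: sub; rewrite inE tp orbT.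
  by apply: eq_in_all => e ew; rewrite !idx // mw.
apply: (iffP andP) => [[/(one_componentP gw)[p tp wE] aw]|[p tp ap]].
  by exists p; rewrite // -(asc p).
have wE : walk w = rcons (map (index^~ w) p) (size w).
  have /andP[tr pw] := tp; rewrite -(trail_traject gw (leq0n _) tr).
  by rewrite (perm_size pw).
split; last by rewrite (asc p).
by apply/(one_componentP gw); exists p.
Qed.

End Conway.

Lemma conway_subst (X T : eqType) (mu : X -> X) (U : seq X) (B I : X -> word T) :
  uniq U -> is_gauss (flatten (map B U)) ->
  {in U, forall x, crossing mu (@mirror T) U B I x} ->
  perm_eq (flatten (map I U)) (flatten (map B U)) ->
  conway (flatten (map B U)) <-> exists2 q, tour mu U q & ascends (flatten (map I q)).
Proof.
move=> uU gW crossU IB; have [uW _ _] := gaussP _ gW.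
split=> [/(conwayP gW)[p /(tour_subst uU uW crossU IB)[q -> tq] ap]|[q tq aq]].
  by exists q.
apply/(conwayP gW); exists (flatten (map I q)) => //.
by apply/(tour_subst uU uW crossU IB); exists q.
Qed.

Section MapWord.
Variables (T T' : eqType) (f : letter T -> letter T').
Hypotheses (fm : forall e, mirror (f e) = f (mirror e))
  (fh : forall e, is_head (f e) = is_head e).
Variable w : word T.
Hypothesis fa : {in w &, forall d e, (arrow (f d) == arrow (f e)) = (arrow d == arrow e)}.
Hypothesis gw : is_gauss w.

Lemma map_inj_gauss : {in w &, injective f}.
Proof.
have [_ _ iw] := gaussP _ gw.
move=> d e dw ew E; have de : arrow d = arrow e by apply/eqP; rewrite -fa // E.
case: (iw _ _ dw ew de) => // dE; have := fh d.
by rewrite E fh dE {2}/is_head /=; case: (is_head e).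
Qed.

Lemma gauss_map : is_gauss (map f w).
Proof.
have [uw mw iw] := gaussP _ gw; apply/gaussP; split.
- by rewrite (map_inj_in_uniq map_inj_gauss).
- by move=> _ /mapP[e ew ->]; rewrite fm map_f ?mw.
move=> _ _ /mapP[d dw ->] /mapP[e ew ->] /eqP; rewrite fa // => /eqP/(iw _ _ dw ew).
by case=> ->; [left | right; rewrite fm].
Qed.

Lemma ascends_map p : {subset p <= w} -> ascends (map f p) = ascends p.
Proof.
move=> pw; rewrite /ascends all_map; apply: eq_in_all => e ep /=.
rewrite fh; case he: (is_head e) => //=; rewrite filter_map.
have -> : [seq d <- p | preim f (fun d => arrow d == arrow (f e)) d]
        = [seq d <- p | arrow d == arrow e].
  by apply: eq_in_filter => d dp /=; rewrite fa ?pw.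
rewrite fm; apply/eqP/eqP => [|->//].
set s := filter _ _; have sw : {subset s <= w}.
  by move=> d; rewrite mem_filter => /andP[_ /pw].
have [_ mw _] := gaussP _ gw.
case: s sw => [|d1 [|d2 [|d3 s]]] //= sw [E1 E2].
have ew := pw e ep; have d1w : d1 \in w by apply: sw; rewrite inE eqxx.
have d2w : d2 \in w by apply: sw; rewrite !inE eqxx orbT.
by congr [:: _; _]; apply: map_inj_gauss => //; apply: mw.
Qed.

(** A renaming is a substitution of one-letter blocks, so tours are renamed
    along with the word. *)
Lemma conway_map : conway (map f w) = conway w.
Proof.
have [uw mw _] := gaussP _ gw.
have fl (s : word T) : flatten (map (fun e => [:: f e]) s) = map f s.
  by elim: s => //= e s ->.
have gf := gauss_map.
have := @conway_subst _ T' (@mirror T) w (fun e => [:: f e]) (fun e => [:: f e]) uw.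
rewrite fl => /(_ gf) H.
apply/idP/idP => [cf|/(conwayP gw)[p tp ap]].
  have [//|q tq aq] := proj1 (H _ (perm_refl _)) cf.
    move=> e ew; split; first exact: mw.
    by exists (f e), [::], [::]; split=> //; exists [::]; rewrite /= fm.
  apply/(conwayP gw); exists q => //; rewrite fl ascends_map // in aq.
  by move=> d; case/andP: tq => _ /perm_mem->.
apply: (proj2 (H _ (perm_refl _))).
  move=> e ew; split; first exact: mw.
  by exists (f e), [::], [::]; split=> //; exists [::]; rewrite /= fm.
exists p; rewrite // fl ascends_map // => d.
by case/andP: tp => _ /perm_mem->.
Qed.

End MapWord.

Lemma conway_closed (T : eqType) (w : word T) (C : pred (letter T)) : is_gauss w ->
  {in w, forall e, onth w 0 = Some e -> ~~ C e} ->
  (forall x y, after (@mirror T) w x = Some y -> C y -> C x) ->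
  has C w -> ~~ conway w.
Proof.
move=> gw C0 cC /hasP[e ew Ce]; apply/negP => /(conwayP gw)[p /andP[tp pw] _].
have Cs : oapp (predC C) true (onth w 0).
  by case E: (onth w 0) => [d|] //=; apply: (C0 d) => //; apply: onth_mem E.
have ep : e \in p by rewrite (perm_mem pw).
by have /negP[] := trail_avoid tp Cs cC ep.
Qed.

(** * Sums over subsets of arrows *)

Local Open Scope ring_scope.

Fixpoint subsets (s : seq nat) : seq (seq nat) :=
  if s is x :: s' then subsets s' ++ map (cons x) (subsets s') else [:: [::]].

Definition set_function (F : seq nat -> int) : Prop :=
  forall A A' : seq nat, A =i A' -> F A = F A'.

Lemma big_subsets_cons x s (F : seq nat -> int) :
  \sum_(A <- subsets (x :: s)) F A
  = \sum_(A <- subsets s) F A + \sum_(A <- subsets s) F (x :: A).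
Proof. by rewrite /= big_cat big_map. Qed.

Lemma subsets_sub s A : A \in subsets s -> {subset A <= s}.
Proof.
elim: s A => [|x s IH] A /=; first by rewrite inE => /eqP->.
rewrite mem_cat => /orP[/IH As y /As|/mapP[A' /IH As ->] y]; rewrite !inE.
  by move->; rewrite orbT.
by case/orP=> [->//|/As->]; rewrite orbT.
Qed.

Lemma set_function_cons F x : set_function F -> set_function (F \o cons x).
Proof. by move=> sF A A' AA /=; apply: sF => y; rewrite !inE AA. Qed.

(** Moving one arrow to the front exchanges the cases in which it is chosen with
    those of the arrows before it. *)
Lemma perm_subsets s t F : set_function F -> perm_eq s t ->
  \sum_(A <- subsets s) F A = \sum_(A <- subsets t) F A.
Proof.
elim: s t F => [|x s IH] t F sF st.
  by have /perm_size/esym/size0nil-> := st.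
have xt : x \in t by rewrite -(perm_mem st) mem_head.
have [t1 [t2 E]] := mem_split xt.
have {}st : perm_eq s (t1 ++ t2).
  by rewrite -(perm_cons x) (permPl st) E -cat1s perm_catCA.
rewrite big_subsets_cons (IH _ _ sF st) (IH _ _ (set_function_cons x sF) st) E.
rewrite -big_subsets_cons; elim: t1 F sF {xt E st} => [//|y t1 IHt] F sF.
rewrite !cat_cons big_subsets_cons [RHS]big_subsets_cons.
rewrite -(IHt _ sF) -(IHt _ (set_function_cons y sF)) !big_subsets_cons /=.
rewrite addrACA; congr (_ + _ + (_ + _)).
by apply: eq_bigr => A _; apply: sF => z; rewrite !inE orbCA.
Qed.

Lemma subsets_filter (P : pred nat) s (F : seq nat -> int) :
  \sum_(A <- subsets s | all P A) F A = \sum_(A <- subsets (filter P s)) F A.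
Proof.
elim: s F => [|x s IH] F; first by rewrite /= !big_cons !big_nil.
rewrite /= big_cat big_map /=; case Px: (P x) => /=.
  by rewrite big_subsets_cons -!IH.
by rewrite [X in _ + X]big_pred0 // addr0 IH.
Qed.

Lemma subsets_map g s (F : seq nat -> int) :
  \sum_(A <- subsets (map g s)) F A = \sum_(A <- subsets s) F (map g A).
Proof.
elim: s F => [|x s IH] F; first by rewrite /= !big_seq1.
by rewrite map_cons !big_subsets_cons !IH.
Qed.

(** The contribution to the coefficient of z ^ N of a diagram in which all
    arrows are smoothed; [N] arrows have [N.*2] endpoints. *)
Definition term (N : nat) (w : word bool) : int :=
  if (size w == N.*2)%N && conway w then weight w else 0.

(** The Conway coefficient of an unlabelled diagram. *)
Definition coef (N : nat) (w : word bool) : int :=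
  \sum_(A <- subsets (arrows w)) term N (subdiagram (mem A) w).

Lemma set_function_term N w : set_function (fun A => term N (subdiagram (mem A) w)).
Proof. by move=> A A' AA; congr term; apply: eq_filter => e /=; apply: AA. Qed.

Lemma coef_perm N w s : uniq s -> s =i map (@arrow bool) w ->
  coef N w = \sum_(A <- subsets s) term N (subdiagram (mem A) w).
Proof. by move=> us sw; apply/perm_subsets/perm_arrows => //; exact: set_function_term. Qed.

(** * Invariance under renaming and the first two moves *)

Definition rename (T : eqType) (g : nat -> nat) (w : word T) : word T :=
  [seq (g (arrow e), is_head e, deco e) | e <- w].

Lemma normal_rename (T : eqType) (w : word T) : normal w = rename (index^~ (arrows w)) w.
Proof. by []. Qed.

Section Rename.
Variables (g : nat -> nat) (w : word bool).
Hypotheses (gi : {in arrows w &, injective g}) (gw : is_gauss w).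

Lemma rename_arrow_eq : {in w &, forall d e, (g (arrow d) == g (arrow e)) = (arrow d == arrow e)}.
Proof. by move=> d e dw ew; rewrite (inj_in_eq gi) ?arrows_mem. Qed.

Lemma gauss_rename : is_gauss (rename g w).
Proof. by apply: gauss_map => //; exact: rename_arrow_eq. Qed.

Lemma conway_rename : conway (rename g w) = conway w.
Proof. by apply: conway_map => //; exact: rename_arrow_eq. Qed.

Lemma weight_rename : weight (rename g w) = weight w.
Proof. by rewrite /weight big_map. Qed.

Lemma term_rename N : term N (rename g w) = term N w.
Proof. by rewrite /term size_map conway_rename weight_rename. Qed.

Lemma subdiagram_rename (A : seq nat) : {subset A <= arrows w} ->
  subdiagram (mem (map g A)) (rename g w) = rename g (subdiagram (mem A) w).
Proof.
move=> Aw; rewrite /subdiagram filter_map; congr map.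
apply: eq_in_filter => e /arrows_mem ew /=; apply/mapP/idP => [[x xA]|eA].
  by move/gi=> -> //; apply: Aw.
by exists (arrow e).
Qed.

End Rename.

Lemma coef_rename N g w : {in arrows w &, injective g} -> is_gauss w ->
  coef N (rename g w) = coef N w.
Proof.
move=> gi gw; rewrite (@coef_perm N _ (map g (arrows w))).
- rewrite subsets_map; apply: eq_big_seq => A /subsets_sub Aw.
  rewrite subdiagram_rename // term_rename ?gauss_subdiagram //.
  by move=> x y; rewrite !mem_arrows_subdiagram => /andP[_ +] /andP[_ +]; apply: gi.
- by rewrite map_inj_in_uniq ?uniq_arrows.
move=> x; rewrite -map_comp; apply/mapP/mapP.
  case=> y; rewrite mem_arrows => /mapP[e ew ->] ->; by exists e.
by case=> e ew ->; exists (arrow e); rewrite ?arrows_mem.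
Qed.

Lemma index_inj_arrows (T : eqType) (w : word T) :
  {in arrows w &, injective (index^~ (arrows w))}.
Proof. exact: (index_inj 0%N). Qed.

Lemma coef_normal N w : is_gauss w -> coef N (normal w) = coef N w.
Proof. by move=> gw; rewrite normal_rename coef_rename //; apply: index_inj_arrows. Qed.

Lemma coef_iso N (w v : word bool) : is_gauss w -> is_gauss v -> iso w v ->
  coef N w = coef N v.
Proof. by move=> gw gv /eqP E; rewrite -coef_normal // E coef_normal. Qed.

Lemma gauss_cat_disjoint (T : eqType) (u v : word T) d e :
  is_gauss u -> is_gauss (u ++ v) -> d \in u -> e \in v -> arrow e != arrow d.
Proof.
move=> /gaussP[_ mu _] /gaussP[uw _ iw] du ev; apply/negP => /eqP E.
have /negP : e \notin u.
  by move: uw; rewrite cat_uniq => /and3P[_ /hasPn/(_ e ev)].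
apply.
have euv : e \in u ++ v by rewrite mem_cat ev orbT.
have duv : d \in u ++ v by rewrite mem_cat du.
by case: (iw e d euv duv E) => ->; rewrite /= ?du ?mu.
Qed.

Section Local.
Variable T : eqType.
Implicit Types (v : word T) (P Q : letter T).

(** The segment between the two endpoints closes up on itself. *)
Lemma conway_isolated v0 v1 P :
  is_gauss (v0 ++ [:: P; mirror P] ++ v1) -> ~~ conway (v0 ++ [:: P; mirror P] ++ v1).
Proof.
set w := _ ++ _ => gw; have [uw _ _] := gaussP _ gw.
have aP : after (@mirror T) w (mirror P) = Some (mirror P).
  by rewrite (after_split uw (l := v0) (r := mirror P :: v1)) // mirrorK.
apply: (conway_closed (C := pred1 (mirror P)) gw).
- move=> e _ e0; apply/eqP => eP; move: e0; rewrite eP => /(onth_index uw).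
  have : w = (v0 ++ [:: P]) ++ mirror P :: v1 by rewrite -catA.
  move: uw => /[swap] ->; rewrite cat_uniq /= => /and3P[_ /norP[nP _] _].
  by rewrite index_cat (negbTE nP) size_cat addn1 addSn.
- move=> x y xy /eqP yP; apply/eqP.
  by apply: (after_inj uw (@mirror_inj T) _ aP); rewrite xy yP.
by rewrite has_cat /= eqxx !orbT.
Qed.

(** The segment between the first two endpoints and the one between the last two
    form a closed component. *)
Lemma conway_antiparallel v0 v1 v2 P Q :
  let w := v0 ++ [:: P; Q] ++ v1 ++ [:: mirror Q; mirror P] ++ v2 in
  is_gauss w -> ~~ conway w.
Proof.
move=> w gw; have [uw _ _] := gaussP _ gw.
have aP : after (@mirror T) w (mirror P) = Some Q.
  by rewrite (after_split uw (l := v0) (r := Q :: v1 ++ [:: mirror Q; mirror P] ++ v2)) // mirrorK.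
have aQ : after (@mirror T) w Q = Some (mirror P).
  rewrite (after_split uw (l := v0 ++ [:: P; Q] ++ v1) (r := mirror P :: v2)) //.
  by rewrite /w -!catA.
have start e s1 s2 : w = s1 ++ e :: s2 -> s1 != [::] -> onth w 0 <> Some e.
  move=> wE s1n /(onth_index uw); move: uw; rewrite wE cat_uniq /= => /and3P[_ /norP[ne _] _].
  by rewrite index_cat (negbTE ne); case: s1 s1n {wE ne}.
apply: (conway_closed (C := pred2 Q (mirror P)) gw).
- move=> e _ e0; apply/norP; split; apply/eqP => eE; move: e0; rewrite eE.
    by apply: (start _ (v0 ++ [:: P])); [rewrite /w -catA | case: (v0)].
  apply: (start _ (v0 ++ [:: P; Q] ++ v1 ++ [:: mirror Q])); last by case: (v0).
  by rewrite /w -!catA.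
- move=> x y xy /orP[]/eqP yE; move: xy; rewrite yE => xy.
    by rewrite (after_inj uw (@mirror_inj T) xy aP) /= eqxx orbT.
  by rewrite (after_inj uw (@mirror_inj T) xy aQ) /= eqxx.
by rewrite has_cat /= eqxx !orbT.
Qed.

(** The traveller meets [mirror Q] right after [P] and [Q] right after
    [mirror P], so the first passes of the two arrows have opposite directions. *)
Lemma conway_parallel v0 v1 v2 P Q :
  let w := v0 ++ [:: P; Q] ++ v1 ++ [:: mirror P; mirror Q] ++ v2 in
  is_head P = is_head Q -> is_gauss w -> ~~ conway w.
Proof.
move=> w PQ gw; have [uw _ _] := gaussP _ gw.
have a2 : after (@mirror T) w (mirror P) = Some Q.
  by rewrite (after_split uw (l := v0) (r := Q :: v1 ++ [:: mirror P; mirror Q] ++ v2)) // mirrorK.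
have a1 : after (@mirror T) w P = Some (mirror Q).
  rewrite (after_split uw (l := v0 ++ [:: P; Q] ++ v1) (r := mirror Q :: v2)) //.
  by rewrite /w -!catA.
have start e s1 s2 : w = s1 ++ e :: s2 -> s1 != [::] -> onth w 0 != Some e.
  move=> wE s1n; apply/eqP => /(onth_index uw); move: uw; rewrite wE cat_uniq /=.
  by case/and3P=> _ /norP[ne _] _; rewrite index_cat (negbTE ne); case: s1 s1n {wE ne}.
apply/negP => /(conwayP gw)[p tp]; rewrite (ascends_index (tour_gauss gw tp)).
have [tr /perm_mem pw] := andP tp.
have up : uniq p by case/gaussP: (tour_gauss gw tp).
have ini : [/\ P \in p, Q \in p, mirror P \in p & mirror Q \in p].
  by rewrite !pw /w !(mem_cat, inE) !eqxx !orbT.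
have [Pp Qp P'p Q'p] := ini.
have iQ : index Q p = (index (mirror P) p).+1.
  apply: (trail_pred uw (@mirror_inj T) tr up a2) => //.
  by apply: (start _ (v0 ++ [:: P])); [rewrite /w -catA | case: (v0)].
have iQ' : index (mirror Q) p = (index P p).+1.
  apply: (trail_pred uw (@mirror_inj T) tr up a1) => //.
  apply: (start _ (v0 ++ [:: P; Q] ++ v1 ++ [:: mirror P])); last by case: (v0).
  by rewrite /w -!catA.
move=> /allP ap; case hP : (is_head P); last first.
  have := ap P Pp; have := ap Q Qp; rewrite -PQ hP /= iQ iQ'.
  by lia.
have := ap _ P'p; have := ap _ Q'p; rewrite !mirrorK /is_head /=.
rewrite -/(is_head P) -/(is_head Q) -PQ hP /= iQ iQ'.
by lia.
Qed.

End Local.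

Lemma coef_omega1 N u0 u1 (e : letter bool) :
  is_gauss (u0 ++ [:: e; mirror e] ++ u1) ->
  coef N (u0 ++ [:: e; mirror e] ++ u1) = coef N (u0 ++ u1).
Proof.
set w := _ ++ _ => gw; set x := arrow e.
have pw : perm_eq w ([:: e; mirror e] ++ u0 ++ u1) by rewrite perm_catCA.
have ge : is_gauss [:: e; mirror e].
  by rewrite /is_gauss /= !inE !eqxx mirrorK eqxx !orbT.
have dx d : d \in u0 ++ u1 -> arrow d != x.
  move=> du; apply: (gauss_cat_disjoint ge _ (mem_head _ _) du).
  by rewrite -(perm_gauss pw).
have xu : x \notin arrows (u0 ++ u1).
  by rewrite mem_arrows; apply/mapP => -[d /dx/negP dx' E]; case: dx'; rewrite E.
rewrite (@coef_perm N w (x :: arrows (u0 ++ u1))).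
- rewrite big_subsets_cons [X in _ + X]big1_seq ?addr0.
    apply: eq_big_seq => A /subsets_sub Au; congr term.
    have xA : x \notin A by apply: contra xu => /Au.
    by rewrite /w !subdiagram_cat /= ?arrow_mirror -/x !(negbTE xA).
  move=> A _; rewrite /term; case: andP => // -[_].
  set v := subdiagram _ _; have gv : is_gauss v by apply: gauss_subdiagram.
  move: gv; rewrite /v /w !subdiagram_cat /= inE ?arrow_mirror -/x eqxx /=.
  by move/conway_isolated/negP.
- by rewrite /= xu uniq_arrows.
move=> y; rewrite (perm_mem (perm_map _ pw)) map_cat mem_cat inE mem_arrows /= !inE.
by rewrite ?arrow_mirror -/x orbb.
Qed.

Lemma perm_eq2 (T : eqType) (s : seq T) a b :
  perm_eq s [:: a; b] -> s = [:: a; b] \/ s = [:: b; a].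
Proof.
move=> sab; have := perm_size sab; case: s sab => [|c [|d [|]]] //= sab _.
have : c \in [:: a; b] by rewrite -(perm_mem sab) mem_head.
rewrite !inE => /orP[]/eqP cE; move: sab; rewrite cE.
  by rewrite perm_cons => /perm_small_eq-> //; left.
have ba : perm_eq [:: a; b] [:: b; a] by rewrite (perm_catC [:: a] [:: b]).
by rewrite (permPr ba) perm_cons => /perm_small_eq-> //; right.
Qed.

Lemma weightE w : weight w = \prod_(e <- w) (if is_head e then sgn (deco e) else 1).
Proof. by rewrite /weight big_mkcond. Qed.

(** The subdiagrams containing exactly one of the two arrows, tails or heads being
    adjacent, differ by a renaming and by one sign. *)
Lemma coef_omega2 N (w v : word bool) : is_gauss v -> omega2 w v -> coef N v = coef N w.
Proof.
move=> + wv; case: wv => u0 u1 u2 B1 B2 x y h s.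
set X := (x, h, s); set Y := (y, h, ~~ s) => pB1 pB2.
set v' := _ ++ _ => gv; set w' := _ ++ _.
have pv : perm_eq v' ([:: X; Y; mirror X; mirror Y] ++ w').
  apply/permP => a; rewrite /v' /w' !count_cat (permP pB1) (permP pB2).
  rewrite /X /Y /mirror /arrow /is_head /deco /=.
  by lia.
have [uv mv iv] := gaussP _ gv.
have xy : x != y.
  apply: contraTneq uv => xy; rewrite (perm_uniq pv) /=.
  apply/negP => /and4P[nX nY _ _].
  have : Y = X \/ Y = mirror X.
    by apply: iv; rewrite ?(perm_mem pv) ?inE ?eqxx ?orbT //= xy.
  by rewrite /X /Y; case=> -[]; case: (s) (h) => -[].
have yx := xy; rewrite eq_sym in yx.
have gB : is_gauss [:: X; Y; mirror X; mirror Y].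
  rewrite /is_gauss /X /Y /mirror /arrow /is_head /deco /= !inE !negbK.
  by rewrite !eqxx (negbTE xy) (negbTE yx) !orbT.
have dB d : d \in w' -> (arrow d != x) /\ (arrow d != y).
  have gv' := gv; rewrite (perm_gauss pv) in gv'.
  by move=> dw; split; [have := gauss_cat_disjoint (d := X) gB gv' _ dw
    | have := gauss_cat_disjoint (d := Y) gB gv' _ dw];
    rewrite !inE eqxx ?orbT; apply.
have xw : x \notin arrows w'.
  by rewrite mem_arrows; apply/mapP => -[d /dB[/negP dx _] E]; case: dx; rewrite E.
have yw : y \notin arrows w'.
  by rewrite mem_arrows; apply/mapP => -[d /dB[_ /negP dy] E]; case: dy; rewrite E.
rewrite (@coef_perm N v' (x :: y :: arrows w')); first last.
- move=> z; rewrite (perm_mem (perm_map _ pv)) map_cat mem_cat !inE mem_arrows /=.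
  by rewrite /arrow /= !orbA; case: (z == x); case: (z == y).
- by rewrite /= inE negb_or xy xw yw uniq_arrows.
pose F (A : seq nat) := term N (subdiagram (mem A) v'); rewrite (eq_bigr F) //.
have F0 : {in subsets (arrows w'), forall A, F A = term N (subdiagram (mem A) w')}.
  move=> A /subsets_sub Aw; rewrite /F; congr term.
  have xA : x \notin A by apply: contra xw => /Aw.
  have yA : y \notin A by apply: contra yw => /Aw.
  rewrite /v' !subdiagram_cat.
  by case: (perm_eq2 pB1) => ->; case: (perm_eq2 pB2) => ->;
    rewrite /= /arrow /= (negbTE xA) (negbTE yA).
have F1 : {in subsets (arrows w'), forall A, F (y :: A) = - F (x :: A)}.
  move=> A /subsets_sub Aw; rewrite /F.
  have xA : x \notin A by apply: contra xw => /Aw.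
  have yA : y \notin A by apply: contra yw => /Aw.
  set vx := subdiagram (mem (x :: A)) v'; set vy := subdiagram _ _.
  have gx : is_gauss vx by apply: gauss_subdiagram.
  (* [f] replaces the arrow [x] by the arrow [y] of the opposite sign. *)
  pose f (e : letter bool) : letter bool :=
    if arrow e == x then (y, is_head e, ~~ deco e) else e.
  have fu u : {subset u <= w'} ->
      subdiagram (mem (y :: A)) u = map f (subdiagram (mem (x :: A)) u).
    elim: u => //= d u IH du; rewrite !inE; have [] := dB d (du d (mem_head _ _)).
    move=> /negbTE dx /negbTE dy; rewrite dx dy /=.
    have {}IH := IH (fun z zu => du z (mem_behead (s := d :: u) zu)).
    by case: ifP => _ //=; rewrite IH /f dx.
  have vyE : vy = map f vx.
    rewrite /vy /vx /v' !subdiagram_cat !map_cat.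
    rewrite (fu u0) ?(fu u1) ?(fu u2); try by move=> d du; rewrite /w' !mem_cat du ?orbT.
    by case: (perm_eq2 pB1) => ->; case: (perm_eq2 pB2) => ->;
      rewrite /= /arrow /= !inE ?eqxx ?(negbTE xy) ?(negbTE yx) ?(negbTE xA) ?(negbTE yA) /=
              /f /arrow /= ?eqxx ?negbK.
  have wx : {in vx, forall e, arrow e != y}.
    move=> e; rewrite mem_filter /= inE => /andP[/orP[/eqP->|eA] _ //].
    by apply: contraNneq yA => <-.
  have fm e : mirror (f e) = f (mirror e) by rewrite /f arrow_mirror; case: ifP.
  have fh e : is_head (f e) = is_head e by rewrite /f; case: ifP.
  have fa : {in vx &, forall d e, (arrow (f d) == arrow (f e)) = (arrow d == arrow e)}.
    move=> d e /wx dy /wx ey; rewrite /f.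
    case: ifP => [/eqP dx|dx]; case: ifP => [/eqP ex|ex] //.
    - by rewrite dx ex /arrow /= !eqxx.
    - by rewrite dx /arrow /= eq_sym (negbTE ey) eq_sym ex.
    - by rewrite ex /arrow /= (negbTE dy) dx.
  rewrite /term vyE size_map (conway_map fm fh fa gx); case: ifP => _; last by rewrite oppr0.
  pose Z : letter bool := (x, true, s).
  have Zx : Z \in vx.
    rewrite mem_filter /= inE eqxx /= (perm_mem pv) !inE /Z /X /Y /mirror /=.
    by case: (h); rewrite eqxx ?orbT.
  have [ux _ ix] := gaussP _ gx.
  rewrite !weightE big_map (bigD1_seq _ Zx) //= (bigD1_seq Z Zx) //=.
  rewrite {1 2}/f /arrow /= eqxx /= -mulNr; congr (_ * _); first by case: (s).
  rewrite big_seq_cond [RHS]big_seq_cond; apply: eq_bigr => e /andP[ex eZ].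
  rewrite fh /f; case: ifP => // he; case: ifP => // /eqP exx.
  by case: (ix e Z ex Zx exx) => E; move: eZ he; rewrite E ?eqxx.
have F2 : {in subsets (arrows w'), forall A, F (x :: y :: A) = 0}.
  move=> A _; rewrite /F /term; set vxy := subdiagram _ _.
  have : is_gauss vxy by apply: gauss_subdiagram.
  suff : is_gauss vxy -> ~~ conway vxy by move=> H /H/negbTE->; rewrite andbF.
  have kB u : all (fun e => (arrow e == x) || (arrow e == y)) u ->
      subdiagram (mem [:: x, y & A]) u = u.
    move/allP=> ux; apply/all_filterP/allP => e /ux /=; rewrite !inE orbA => ->.
    by [].
  rewrite /vxy /v' !subdiagram_cat; have {kB} [-> ->] :
      subdiagram (mem [:: x, y & A]) B1 = B1 /\ subdiagram (mem [:: x, y & A]) B2 = B2.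
    split; apply: kB; rewrite ?(perm_all _ pB1) ?(perm_all _ pB2) /=;
      by rewrite /arrow /= !eqxx !orbT.
  case: (perm_eq2 pB1) => ->; case: (perm_eq2 pB2) => ->.
  - exact: (@conway_parallel _ _ _ _ X Y).
  - exact: (@conway_antiparallel _ _ _ _ X Y).
  - exact: (@conway_antiparallel _ _ _ _ Y X).
  - exact: (@conway_parallel _ _ _ _ Y X).
rewrite !big_subsets_cons -addrA (eq_big_seq _ F0).
rewrite -[RHS]addr0; congr (coef N w' + _).
rewrite addrA [X in _ + X]big1_seq ?addr0; last by move=> A /andP[_]; apply: F2.
by rewrite -big_split big1_seq //= => A /F1->; rewrite addNr.
Qed.

Local Open Scope nat_scope.

(** * Words with three intervals left open *)

Section Templates.
Variable T : eqType.
Notation slot := (letter T + nat)%type.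
Implicit Types (U q : seq slot) (b t : nat -> word T).

Definition lefts U : word T := pmap (fun x => if x is inl e then Some e else None) U.
Definition rights U : seq nat := pmap (fun x => if x is inr i then Some i else None) U.

Definition place b (x : slot) : word T := match x with inl e => [:: e] | inr i => b i end.
Definition expand b U : word T := flatten (map (place b) U).

(** A traveller that enters the interval [i] leaves at the end of the interval
    [sigma i]. *)
Definition jump (sigma : nat -> nat) (x : slot) : slot :=
  match x with inl e => inl (mirror e) | inr i => inr (sigma i) end.

Lemma perm_parts U : perm_eq U (map inl (lefts U) ++ map inr (rights U)).
Proof.
elim: U => [|[e|i] U IH] //=; first by rewrite perm_cons.
by rewrite perm_sym perm_catC /= perm_cons perm_sym (permPl IH) perm_catC.
Qed.

Lemma mem_lefts U e : (e \in lefts U) = (inl e \in U).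
Proof. by elim: U => [|[d|i] U IH] //=; rewrite !inE IH. Qed.

Lemma mem_rights U i : (i \in rights U) = (inr i \in U).
Proof. by elim: U => [|[d|j] U IH] //=; rewrite !inE IH. Qed.

Lemma uniq_parts U : uniq (lefts U) -> uniq (rights U) -> uniq U.
Proof.
move=> ul ur; rewrite (perm_uniq (perm_parts U)) cat_uniq !map_inj_uniq ?ul ?ur;
  try by move=> x y [].
by rewrite andbT /=; apply/hasPn => _ /mapP[i _ ->]; apply/mapP => -[].
Qed.

Lemma perm_expand b U :
  perm_eq (expand b U) (lefts U ++ flatten (map b (rights U))).
Proof.
have /(perm_map (place b))/perm_flatten/perm_trans := perm_parts U; apply.
rewrite map_cat flatten_cat -!map_comp perm_cat //.
by elim: (lefts U) => //= e s; rewrite perm_cons.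
Qed.

Lemma filter_expand (P : pred (letter T)) b U :
  filter P (expand b U)
  = expand (filter P \o b) (filter (fun x => if x is inl e then P e else true) U).
Proof.
rewrite /expand; elim: U => [|[e|i] U IH] //=; rewrite ?filter_cat IH //.
by case: ifP.
Qed.

(** Each arrow is tested on its own two letters. *)
Lemma ascends_split (P : pred nat) (p : word T) :
  ascends p = ascends [seq e <- p | P (arrow e)]
              && ascends [seq e <- p | ~~ P (arrow e)].
Proof.
rewrite {1}/ascends -(perm_all _ (permEl (perm_filterC (P \o @arrow T) p))) all_cat.
congr (_ && _); apply: eq_in_all => e; rewrite mem_filter => /andP[/= Pe _];
  congr (_ || (_ == _)); rewrite -filter_predI; apply: eq_filter => d /=;
  by case: eqP => // ->.
Qed.

(** A decidable form of [threads] for three intervals with at most two endpoints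
    each, where consecutive endpoints fill a whole interval. *)
Fixpoint threads_in b (z : nat) (y : letter T) (s : word T) : bool :=
  if s is y' :: s' then has (fun i => b i == [:: mirror y; y']) (iota 0 3)
                        && threads_in b z y' s'
  else if b z is d :: r then last d r == mirror y else false.

(** The traveller entering the interval [i] filled with [b i] runs through
    [t i] and leaves at the end of the interval [sigma i]; no letter of the
    intervals is missed. *)
Definition routes (sigma : nat -> nat) b t : bool :=
  all (fun i => [&& sigma i < 3,
        (if b i is d :: _ then ohead (t i) == Some d else false)
      & (if t i is y :: s then threads_in b (sigma i) y s else false)]) (iota 0 3)
  && perm_eq (flatten (map t (iota 0 3))) (flatten (map b (iota 0 3))).

Definition template U : Prop := is_gauss (lefts U) /\ perm_eq (rights U) (iota 0 3).

(** The outer part of the tour, and whether it is ascending there, depends on the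
    filling only through [sigma]; the arrows inside contribute one more
    condition, on the order in which the intervals are entered. *)
Lemma conway_expand sigma b t U : template U -> routes sigma b t ->
  is_gauss (expand b U) ->
  conway (expand b U) <->
  exists2 q, tour (jump sigma) U q & ascends (lefts q) && ascends (flatten (map t (rights q))).
Proof.
case=> gl pr /andP[/allP loc ptb] gW.
have [ul ml _] := gaussP _ gl.
have uU : uniq U by rewrite uniq_parts // (perm_uniq pr).
have inU i : (inr i \in U) = (i \in iota 0 3) by rewrite -mem_rights (perm_mem pr).
have th z y s : threads_in b z y s -> threads (@mirror T) U (place b) (inr z) y s.
  elim: s y => [|y' s IH] y; first move=> /=.
    case: (b z) => [|d r] // /eqP E; exists (belast d r); by rewrite -E lastI.
  case/andP=> /hasP[i i3 /eqP bi] /IH; split=> //.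
  by exists (inr i), [::], [::]; rewrite inU.
have cr : {in U, forall x, crossing (jump sigma) (@mirror T) U (place b) (place t) x}.
  move=> [e|i] xU; split=> /=.
  - by rewrite -mem_lefts ml // mem_lefts.
  - exists e, [::], [::]; split=> //; by exists [::].
  - by have /and3P[s3 _ _] := loc i (etrans (esym (inU i)) xU); rewrite inU mem_iota.
  have /and3P[_] := loc i (etrans (esym (inU i)) xU).
  case: (b i) => // d r; case: (t i) => // y s /eqP[<-] /th ths.
  by exists y, s, r.
have IB : perm_eq (flatten (map (place t) U)) (flatten (map (place b) U)).
  rewrite (permPl (perm_expand t U)) (permPr (perm_expand b U)) perm_cat2l.
  rewrite (permPl (perm_flatten (perm_map t pr))).
  by rewrite (permPr (perm_flatten (perm_map b pr))).
have dis d e : d \in lefts U -> e \in flatten (map b (rights U)) -> arrow e != arrow d.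
  by apply: gauss_cat_disjoint => //; rewrite -(perm_gauss (perm_expand b U)).
have split_q q : tour (jump sigma) U q ->
  ascends (flatten (map (place t) q))
  = ascends (lefts q) && ascends (flatten (map t (rights q))).
  case/andP=> _ qU.
  pose P x := x \in map (@arrow T) (lefts U).
  have inP i : inr i \in U -> {in t i, forall e, ~~ P (arrow e)}.
    move=> iU e eti; apply/mapP => -[d dl E].
    have : e \in flatten (map b (rights U)).
      rewrite (perm_mem (perm_flatten (perm_map b pr))) -(perm_mem ptb).
      by apply/flattenP; exists (t i); rewrite ?map_f // -inU.
    by move/(dis _ _ dl); rewrite E eqxx.
  have outP e : inl e \in U -> P (arrow e) by rewrite -mem_lefts; apply: map_f.
  have {qU} : {subset q <= U} by move=> x; rewrite (perm_mem qU).
  rewrite (ascends_split P (flatten _)) => sq; congr (_ && _); congr ascends.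
    elim: q sq => [//|[e|i] q IH] sq /=.
      rewrite outP ?sq ?mem_head //= IH // => x xq; apply: sq.
      by rewrite inE xq orbT.
    rewrite filter_cat IH => [|x xq]; last by apply: sq; rewrite inE xq orbT.
    rewrite (eq_in_filter (a2 := pred0)) ?filter_pred0 // => e /inP-/(_ _)/negbTE.
    by apply; rewrite sq ?mem_head.
  elim: q sq => [//|[e|i] q IH] sq /=.
    rewrite outP ?sq ?mem_head //= IH // => x xq; apply: sq.
    by rewrite inE xq orbT.
  rewrite filter_cat IH => [|x xq]; last by apply: sq; rewrite inE xq orbT.
  congr (_ ++ _); apply/all_filterP/allP => e; apply: inP.
  by rewrite sq ?mem_head.
rewrite (conway_subst uU gW cr IB); split=> -[q tq]; exists q => //.
  by rewrite -split_q.
by rewrite split_q.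
Qed.

End Templates.

Local Open Scope ring_scope.

(** * Invariance under the third move *)

(** The three intervals with the arrows 0, 1, 2 running 1 -> 2, 1 -> 3 and
    2 -> 3; all finite verifications are made on this copy. *)
Definition triangle (i : nat) : word bool :=
  nth [::] [:: [:: (0, false, true); (1, false, true)];
               [:: (0, true, true); (2, false, true)];
               [:: (1, true, true); (2, true, true)]]%N i.

Definition side (r : bool) (S : seq nat) (i : nat) : word bool :=
  let B := subdiagram (mem S) (triangle i) in if r then rev B else B.

Definition full_triangle : word bool := flatten (map triangle (iota 0 3)).

(** What has to be verified about the triangle with the arrows [S] (reversed
    if [r]) when its routes are [t]. *)
Definition side_routes (sigma : nat -> nat) (r : bool) (S : seq nat) (t : nat -> word bool) : bool :=
  [&& all (mem (iota 0 3)) S, routes sigma (side r S) t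
    & all (fun i => all (mem full_triangle) (t i)) (iota 0 3)].

Section Triangle.
Variables (a b c : nat) (s : bool).
Hypotheses (ab : a != b) (ac : a != c) (bc : b != c).

Definition name (i : nat) : nat := nth 0%N [:: a; b; c] i.

Definition paint (e : letter bool) : letter bool := (name (arrow e), is_head e, s).

Lemma paint_mirror e : mirror (paint e) = paint (mirror e). Proof. by []. Qed.

Lemma name_inj : {in iota 0 3 &, injective name}.
Proof.
have u : uniq [:: a; b; c] by rewrite /= !inE negb_or ab ac bc.
by move=> i j; rewrite !mem_iota /= => i3 j3 /eqP; rewrite nth_uniq // => /eqP.
Qed.

Lemma full_arrow : {in full_triangle, forall e, arrow e \in iota 0 3}.
Proof. by apply/allP. Qed.

Lemma paint_arrow : {in full_triangle &, forall d e,
  (arrow (paint d) == arrow (paint e)) = (arrow d == arrow e)}.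
Proof.
by move=> d e /full_arrow di /full_arrow ei; rewrite /paint (inj_in_eq name_inj).
Qed.

Lemma gauss_full : is_gauss full_triangle. Proof. by []. Qed.

Lemma flatten_paint (u : nat -> word bool) o :
  flatten (map (map paint \o u) o) = map paint (flatten (map u o)).
Proof. by rewrite map_flatten -map_comp. Qed.

Lemma routes_paint sigma B t :
  routes sigma B t -> routes sigma (map paint \o B) (map paint \o t).
Proof.
case/andP=> /allP loc pt; apply/andP; split; last first.
  by rewrite !flatten_paint perm_map.
apply/allP => i /loc /and3P[-> Bt ti] /=; apply/andP; split.
  case: (B i) Bt => // d l; case: (t i) {ti} => //= y u /eqP[->].
  by rewrite eqxx.
case: (t i) ti {Bt} => // y u; elim: u y => [|y' u IH] y.
  by move=> /=; case: (B (sigma i)) => //= d r /eqP yE; rewrite last_map yE.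
case/andP=> /hasP[j j3 /eqP Bj] /IH tu; apply/andP; split=> //.
by apply/hasP; exists j; rewrite //= Bj /= paint_mirror.
Qed.

Variable U : seq (letter bool + nat).
Hypothesis tU : template U.

Definition fill (r : bool) (S : seq nat) : word bool :=
  expand (map paint \o side r S) U.

Hypothesis gfill : forall r S, all (mem (iota 0 3)) S -> is_gauss (fill r S).

Lemma conway_fill sigma r S t : side_routes sigma r S t ->
  conway (fill r S) <->
  exists q, [/\ tour (jump sigma) U q, ascends (lefts q)
              & ascends (flatten (map t (rights q)))].
Proof.
case/and3P=> S3 /routes_paint rt /allP sub.
have -> : conway (fill r S) <-> _ := conway_expand tU rt (gfill r S3).
have asc q : tour (jump sigma) U q ->
    ascends (flatten (map (map paint \o t) (rights q)))
    = ascends (flatten (map t (rights q))).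
  case/andP=> _ qU; rewrite flatten_paint.
  apply: (ascends_map _ _ paint_arrow gauss_full) => //.
  move=> e /flattenP[_ /mapP[i + ->]]; rewrite mem_rights (perm_mem qU) -mem_rights.
  by case: tU => _ /perm_mem-> /sub/allP; apply.
split=> [[q tq /andP[l rq]]|[q [tq l rq]]]; exists q; rewrite // ?l ?asc //.
by rewrite -asc.
Qed.

(** Fillings with the same connections have the same tour outside, and the
    orders of the three intervals split accordingly. *)
Lemma conway_fill_split sigma r1 S1 t1 r2 S2 t2 r3 S3 t3 :
  [&& side_routes sigma r1 S1 t1, side_routes sigma r2 S2 t2
    & side_routes sigma r3 S3 t3] ->
  all (fun o => let acc t := ascends (flatten (map t o)) in
         (acc t3 == acc t1 || acc t2) && ~~ (acc t1 && acc t2))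
      (permutations (iota 0 3)) ->
  (conway (fill r1 S1) + conway (fill r2 S2))%N = conway (fill r3 S3).
Proof.
case/and3P=> /conway_fill c1 /conway_fill c2 /conway_fill c3 /allP orders.
have ord q : tour (jump sigma) U q -> rights q \in permutations (iota 0 3).
  case/andP=> _ qU; rewrite mem_permutations.
  case: tU => _; apply: perm_trans; exact: perm_pmap.
have [/c1[q [tq lq aq]]|n1] := boolP (conway (fill r1 S1)).
  have /andP[/eqP a3 a12] := orders _ (ord q tq); rewrite aq /= in a3 a12.
  have -> : conway (fill r3 S3) by apply/c3; exists q; split; rewrite // a3.
  have /negbTE-> // : ~~ conway (fill r2 S2).
  apply: contra a12 => /c2[q' [tq' _ aq']].
  by rewrite (trail_uniq (proj1 (andP tq)) (proj1 (andP tq'))).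
have [/c2[q [tq lq aq]]|n2] := boolP (conway (fill r2 S2)).
  have /andP[/eqP a3 _] := orders _ (ord q tq); rewrite aq orbT in a3.
  by have -> : conway (fill r3 S3) by apply/c3; exists q; split; rewrite // a3.
have /negbTE-> // : ~~ conway (fill r3 S3).
apply/negP => /c3[q [tq lq aq]].
have /andP[/eqP a3 _] := orders _ (ord q tq); rewrite aq in a3.
case/orP: (esym a3) => ai; [case/negP: n1; apply/c1 | case/negP: n2; apply/c2];
  by exists q.
Qed.

(** A route lists the endpoints met from entering an interval to leaving the three
    of them, [T x] being the tail and [H x] the head of the arrow [x]. *)
Let rt (ts : seq (seq (nat * bool))) (i : nat) : word bool :=
  [seq (p, true) | p <- nth [::] ts i].
Let T (x : nat) := (x, false).
Let H (x : nat) := (x, true).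

(** Here the intervals are connected as 1 -> 2 -> 3 -> 1.  The pairs on the left
    require the order 1, 2, 3 or 2, 1, 3 of the intervals along the tour, and the
    pair on the right admits both orders. *)
Lemma fill_forward :
  (conway (fill false [:: 0; 1]) + conway (fill false [:: 1; 2]))%N
  = conway (fill true [:: 0; 2])%N.
Proof.
exact: (@conway_fill_split (nth 0 [:: 1; 2; 0]%N)
  _ _ (rt [:: [:: T 0]; [:: H 0; T 1]; [:: H 1]])
  _ _ (rt [:: [:: T 1; H 2]; [:: T 2]; [:: H 1]])
  _ _ (rt [:: [:: T 0]; [:: T 2]; [:: H 2; H 0]])).
Qed.

(** Here the connections are 1 -> 3 -> 2 -> 1, and the orders in question are
    1, 3, 2 and 1, 2, 3. *)
Lemma fill_backward :
  (conway (fill true [:: 0; 1]) + conway (fill true [:: 1; 2]))%N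
  = conway (fill false [:: 0; 2])%N.
Proof.
exact: (@conway_fill_split (nth 0 [:: 2; 0; 1]%N)
  _ _ (rt [:: [:: T 1]; [:: H 0]; [:: H 1; T 0]])
  _ _ (rt [:: [:: T 1]; [:: T 2; H 1]; [:: H 2]])
  _ _ (rt [:: [:: T 0; T 2]; [:: H 0]; [:: H 2]])).
Qed.

(** All three arrows connect 1 -> 3, 2 -> 2 and 3 -> 1 on both sides of the move and
    require the order 1, 2, 3. *)
Lemma fill_full : conway (fill false [:: 0; 1; 2]%N) = conway (fill true [:: 0; 1; 2]%N).
Proof.
pose t1 := rt [:: [:: T 0; T 2]; [:: H 0; T 1; H 2]; [:: H 1]].
pose t2 := rt [:: [:: T 1]; [:: T 2; H 1; T 0]; [:: H 2; H 0]].
have r1 : side_routes (nth 0 [:: 2; 1; 0]%N) false [:: 0; 1; 2]%N t1 by [].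
have r2 : side_routes (nth 0 [:: 2; 1; 0]%N) true [:: 0; 1; 2]%N t2 by [].
have tt : all (fun o => ascends (flatten (map t1 o)) == ascends (flatten (map t2 o)))
    (permutations (iota 0 3)) by [].
have ord q : tour (jump (nth 0 [:: 2; 1; 0]%N)) U q ->
    ascends (flatten (map t1 (rights q))) = ascends (flatten (map t2 (rights q))).
  case/andP=> _ qU; apply/eqP/(allP tt); rewrite mem_permutations.
  by case: tU => _; apply: perm_trans; exact: perm_pmap.
by apply/idP/idP=> [/(conway_fill r1)|/(conway_fill r2)] [q [tq lq aq]];
  [apply/(conway_fill r2) | apply/(conway_fill r1)]; exists q; split; rewrite // ?ord // -ord.
Qed.

(** With at most one arrow, no interval contains two endpoints to be exchanged. *)
Lemma fill_small (S : seq nat) : (size S <= 1)%N -> uniq S -> fill true S = fill false S.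
Proof.
move=> S1 uS; congr flatten; apply: eq_map => -[//|i] /=; congr map.
rewrite /side.
suff : (size (subdiagram (mem S) (triangle i)) <= 1)%N by case: subdiagram => [|? []].
rewrite size_filter; case: S S1 uS => [|x [|]] //= _ _.
  by rewrite (eq_count (a2 := pred0)) ?count_pred0.
rewrite (eq_count (a2 := fun e => arrow e == x)); last by move=> e; rewrite /= inE.
by case: i => [|[|[|i]]]; rewrite /triangle /= ?nth_nil //; case: x => [|[|[|x]]].
Qed.

(** The factor of [term] that only depends on the set of letters. *)
Let kappa N (w : word bool) : int := if (size w == N.*2)%N then weight w else 0.

Let termE N w : term N w = kappa N w *+ conway w.
Proof. by rewrite /term /kappa; case: eqP; case: conway; rewrite //= ?mul0rn. Qed.

Let perm_fill r S :
  perm_eq (fill r S) (lefts U ++ map paint (flatten (map (side false S) (iota 0 3)))).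
Proof.
rewrite (permPl (perm_expand _ _)) perm_cat2l flatten_paint perm_map //.
case: tU => _ pr; rewrite (permPl (perm_flatten (perm_map _ pr))).
by case: r => //=; rewrite !perm_cat // perm_rev.
Qed.

Let kappa_fill N r S :
  kappa N (fill r S) = if (size (lefts U) + size (flatten (map (side false S) (iota 0 3))) == N.*2)%N
    then weight (lefts U) * sgn s ^+ count (@is_head bool) (flatten (map (side false S) (iota 0 3)))
    else 0.
Proof.
rewrite /kappa (perm_size (perm_fill r S)) size_cat size_map; case: ifP => // _.
rewrite /weight (perm_big _ (perm_fill r S)) big_cat big_map; congr (_ * _).
elim: (flatten (map (side false S) (iota 0 3))) => [|e w IH]; first by rewrite big_nil.
by rewrite big_cons IH /= -[is_head (paint e)]/(is_head e); case: (is_head e); rewrite /= ?add1n ?add0n ?exprS.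
Qed.

Let subset_sum N r : int :=
  \sum_(S <- subsets [:: 0; 1; 2]%N) term N (fill r S).

Lemma fill_sum N : subset_sum N false = subset_sum N true.
Proof.
rewrite /subset_sum /= !big_cons big_nil !termE.
rewrite -(@fill_small [::]) // -(@fill_small [:: 0]%N) // -(@fill_small [:: 1]%N) //.
rewrite -(@fill_small [:: 2]%N) // fill_full -fill_backward -fill_forward.
rewrite !kappa_fill /= !mulrnDr; set k2 := (if _ == _ then _ * sgn s ^+ 2 else _).
rewrite -/k2 big_nil.
by rewrite !addr0; ring.
Qed.

End Triangle.

Local Arguments side : simpl never.

(** An Omega3 move, with the three intervals in any order, as a template with
    two fillings. *)
Lemma omega3_template (w v : word bool) : omega3 w v -> is_gauss w ->
  exists a b c s U, let K := map (paint a b c s) full_triangle in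
  [/\ [/\ w = fill a b c s U false [:: 0; 1; 2]%N,
          v = fill a b c s U true [:: 0; 1; 2]%N & template U],
      [/\ a != b, a != c & b != c], is_gauss K
    & perm_eq w (lefts U ++ K)].
Proof.
case=> u0 u1 u2 u3 B1 B2 B3 a b c s pB; set w' := _ ++ _ => gw.
have side_full r i : side r [:: 0; 1; 2]%N i = if r then rev (triangle i) else triangle i.
  have E : subdiagram (mem [:: 0; 1; 2]%N) (triangle i) = triangle i.
    by case: i => [|[|[|i]]]; rewrite /triangle /= ?nth_nil.
  by rewrite /side E.
have [Is pI] : exists2 Is, perm_eq Is (iota 0 3)
    & [:: B1; B2; B3] = map (map (paint a b c s) \o triangle) Is.
  have /(perm_iotaP [::])[Is pI E] := pB; exists Is; rewrite // E.
  apply/eq_in_map => i; rewrite (perm_mem pI) mem_iota /=.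
  by case: i => [|[|[|i]]].
case: Is pI => [|i [|j [|k [|]]]] // pI [E1 E2 E3].
pose U : seq (letter bool + nat) :=
  map inl u0 ++ inr i :: map inl u1 ++ inr j :: map inl u2 ++ inr k :: map inl u3.
have pl u : pmap (fun x : letter bool + nat => if x is inl e then Some e else None)
    (map inl u) = u by elim: u => //= e u ->.
have pr u : pmap (fun x : letter bool + nat => if x is inr e then Some e else None)
    (map inl u) = [::] by elim: u.
have lU : lefts U = u0 ++ u1 ++ u2 ++ u3.
  by rewrite /lefts /U !(pmap_cat, pl) /= !(pmap_cat, pl) /= !(pmap_cat, pl) /= pl.
have rU : rights U = [:: i; j; k].
  by rewrite /rights /U !(pmap_cat, pr) /= !(pmap_cat, pr) /= !(pmap_cat, pr) /= pr.
have fl g u : flatten (map (place g) (map inl u)) = u :> word bool.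
  by elim: u => //= e u ->.
have wE : w' = fill a b c s U false [:: 0; 1; 2]%N.
  rewrite /fill /expand /U !(map_cat, flatten_cat, fl) /= !(map_cat, flatten_cat, fl) /=.
  rewrite !(map_cat, flatten_cat, fl) /= fl !side_full.
  by rewrite /w' E1 E2 E3.
have vE : u0 ++ rev B1 ++ u1 ++ rev B2 ++ u2 ++ rev B3 ++ u3
    = fill a b c s U true [:: 0; 1; 2]%N.
  rewrite /fill /expand /U !(map_cat, flatten_cat, fl) /= !(map_cat, flatten_cat, fl) /=.
  rewrite !(map_cat, flatten_cat, fl) /= fl !side_full !map_rev.
  by rewrite E1 E2 E3.
set K := map (paint a b c s) full_triangle.
have wp : perm_eq w' (lefts U ++ K).
  rewrite wE (permPl (perm_expand _ _)) perm_cat2l flatten_paint perm_map //.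
  rewrite rU (permPl (perm_flatten (perm_map _ pI))).
  by rewrite (eq_map (side_full false)).
have [uw mw _] := gaussP _ gw.
have uK : uniq K by move: uw; rewrite (perm_uniq wp) cat_uniq => /and3P[].
have ab : a != b.
  by apply: contraTneq uK => E; rewrite /K E /= /paint /name /arrow /= !inE !eqxx.
have ac : a != c.
  by apply: contraTneq uK => E; rewrite /K E /= /paint /name /arrow /= !inE !eqxx !orbT.
have bc : b != c.
  apply: contraTneq uK => E; rewrite /K E /= /paint /name /arrow /= !inE !eqxx !orbT.
  by rewrite !andbF.
have gK : is_gauss K by apply: gauss_map gauss_full => //; exact: paint_arrow.
have dis d e : d \in K -> e \in lefts U -> arrow e != arrow d.
  apply: gauss_cat_disjoint => //.
  by rewrite (perm_gauss (_ : perm_eq _ (lefts U ++ K))) -?(perm_gauss wp) // perm_catC.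
exists a, b, c, s, U; split=> //; split=> //; split; last by rewrite rU.
pose P x := x \notin map (@arrow bool) K.
suff <- : subdiagram P (lefts U ++ K) = lefts U.
  by rewrite -(perm_gauss (perm_filter _ wp)); apply: gauss_subdiagram.
rewrite subdiagram_cat -[RHS]cats0; congr (_ ++ _).
  apply/all_filterP/allP => e el; apply/mapP => -[d dK E].
  by move: (dis d e dK el); rewrite E eqxx.
by rewrite -[RHS](filter_pred0 K); apply: eq_in_filter => e eK; rewrite /P map_f.
Qed.

(** Choosing arrows of the triangle and arrows outside are independent. *)
Lemma subset_fill a b c s U r (S A : seq nat) :
  a != b -> a != c -> b != c -> {subset S <= iota 0 3} ->
  {in [:: a; b; c], forall x, x \notin A} ->
  {in map (@arrow bool) (lefts U), forall x, x \notin [:: a; b; c]} ->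
  subdiagram (mem (map (name a b c) S ++ A)) (fill a b c s U r [:: 0; 1; 2]%N)
  = fill a b c s (filter (fun x => if x is inl e then arrow e \in A else true) U) r S.
Proof.
move=> ab ac bc S3 nA Ul; rewrite /fill /subdiagram filter_expand.
have ni := name_inj ab ac bc.
have nS x : x \in [:: a; b; c] -> x \notin A by apply: nA.
congr flatten; rewrite (eq_in_filter (a2 :=
  fun x => if x is inl e then arrow e \in A else true)).
  apply: eq_map => -[//|i] /=; rewrite filter_map; congr map.
  rewrite /side; set B := triangle i.
  have Bi : {in B, forall e, arrow e \in iota 0 3}.
    by rewrite /B; case: (i) => [|[|[|j]]] e; rewrite /triangle /= ?nth_nil ?inE //=;
      case/orP => /eqP->.
  have E : {in B, preim (paint a b c s) (fun e => mem (map (name a b c) S ++ A) (arrow e))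
                  =1 (fun e => arrow e \in S)}.
    move=> e /Bi ei /=; rewrite mem_cat.
    have /negbTE-> : name a b c (arrow e) \notin A.
      apply: nA; move: ei; rewrite mem_iota /= => ei.
      by rewrite /name mem_nth.
    rewrite orbF; apply/mapP/idP => [[x xS]|eS]; last by exists (arrow e).
    by move/ni=> -> //; apply: S3.
  have B3 : subdiagram (mem [:: 0; 1; 2]%N) B = B by apply/all_filterP/allP => e /Bi.
  rewrite B3; case: r; last exact: eq_in_filter E.
  by rewrite filter_rev (eq_in_filter E).
move=> [e|//] eU /=; rewrite mem_cat.
have /negbTE-> // : arrow e \notin map (name a b c) S.
have /Ul : arrow e \in map (@arrow bool) (lefts U) by rewrite map_f ?mem_lefts.
apply: contra => /mapP[i /S3]; rewrite mem_iota /= => i3 ->.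
by rewrite /name mem_nth.
Qed.

(** For each choice of arrows outside the triangle, the contributions of the eight
    subsets of the triangle have the same sum. *)
Lemma coef_omega3 N (w v : word bool) : is_gauss w -> omega3 w v -> coef N w = coef N v.
Proof.
move=> gw /omega3_template/(_ gw)[a [b [c [s [U [[wE vE [gl rU]] [ab ac bc] gK wp]]]]]].
set K := map _ _ in gK wp.
have vw : perm_eq v w.
  rewrite wE vE /fill (permPl (perm_expand _ _)) (permPr (perm_expand _ _)) perm_cat2l.
  rewrite !flatten_paint perm_map //.
  by elim: (rights U) => //= i I IH; apply: perm_cat; rewrite // /side perm_rev.
have dis : {in map (@arrow bool) (lefts U), forall x, x \notin [:: a; b; c]}.
  move=> _ /mapP[e el ->].
  have ne : {in iota 0 3, forall i, arrow e != name a b c i}.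
    move=> i i3; have [d dK <-] : exists2 d, d \in K & arrow d = name a b c i.
      have /mapP[d df ->] : i \in map (@arrow bool) full_triangle.
        by move: i3; rewrite mem_iota; case: i => [|[|[|]]].
      by exists (paint a b c s d); rewrite ?map_f.
    apply: (gauss_cat_disjoint gK _ dK el).
    by rewrite (perm_gauss (_ : perm_eq _ w)) // perm_catC perm_sym.
  by rewrite !inE !negb_or (ne 0%N) ?(ne 1%N) ?(ne 2%N).
set rest := arrows (lefts U).
have us : uniq [:: a, b, c & rest].
  have nr x : x \in [:: a; b; c] -> x \notin rest.
    by move=> xa; rewrite mem_arrows; apply: contraL xa => /dis.
  by rewrite /= !inE !negb_or ab ac bc !nr ?uniq_arrows // !inE eqxx ?orbT.
have mem_s x : (x \in [:: a, b, c & rest]) = (x \in map (@arrow bool) w).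
  rewrite (perm_mem (perm_map _ wp)) map_cat mem_cat !inE mem_arrows.
  rewrite /paint /name /arrow /=.
  by case: (x == a); case: (x == b); case: (x == c); rewrite ?orbT ?orbF.
have coefE r : (if r then v else w) = fill a b c s U r [:: 0; 1; 2]%N ->
  coef N (if r then v else w) = \sum_(A <- subsets rest) \sum_(S <- subsets [:: 0; 1; 2]%N)
    term N (fill a b c s (filter (fun x => if x is inl e then arrow e \in A else true) U) r S).
  move=> E; rewrite (@coef_perm N _ [:: a, b, c & rest]) //; last first.
    by move=> x; rewrite mem_s; case: (r) => //; rewrite (perm_mem (perm_map _ vw)).
  rewrite E !big_subsets_cons -!big_split /=; apply: eq_big_seq => A /subsets_sub Ar.
  have nA : {in [:: a; b; c], forall x, x \notin A}.
    move=> x xa; apply/negP => /Ar; rewrite mem_arrows => /dis; by rewrite xa.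
  have F S : {subset S <= iota 0 3} -> _ := fun H => subset_fill s r ab ac bc H nA dis.
  rewrite !big_cons big_nil -!F //= /name /=; try by move=> x; rewrite !inE; do ?case/orP; move/eqP->.
  by rewrite addr0 !addrA.
have -> := coefE false wE; have -> := coefE true vE.
apply: eq_big_seq => A /subsets_sub Ar; set UA := filter _ U.
have tUA : template UA.
  have lUA : lefts UA = subdiagram (mem A) (lefts U).
    by rewrite /UA; elim: (U) => [|[e|i] V IH] //=; case: ifP => _ /=; rewrite IH.
  have rUA : rights UA = rights U.
    by rewrite /UA; elim: (U) => [|[e|i] V IH] //=; [case: ifP => _ /= | rewrite IH].
  by split; rewrite ?rUA // lUA gauss_subdiagram.
have nA : {in [:: a; b; c], forall x, x \notin A}.
  by move=> x xa; apply/negP => /Ar; rewrite mem_arrows => /dis; rewrite xa.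
apply: (fill_sum ab ac bc tUA) => r S /allP S3.
rewrite -(subset_fill s r ab ac bc S3 nA dis); apply: gauss_subdiagram.
by case: r; rewrite -?vE -?wE // (perm_gauss vw).
Qed.

Local Open Scope nat_scope.

(** * Gaussian parity and functoriality of the deletion of odd arrows *)

(** The parity of the sum of the positions of [x] in [s], counted from an odd
    position if [b]. *)
Fixpoint position_parity (b : bool) (s : seq nat) (x : nat) : bool :=
  if s is y :: s' then ((y == x) && b) (+) position_parity (~~ b) s' x else false.

Lemma position_parity_cat b s t x :
  position_parity b (s ++ t) x
  = position_parity b s x (+) position_parity (b (+) odd (size s)) t x.
Proof.
elim: s b => [|y s IH] b /=; first by rewrite addbF.
by rewrite IH addbA addNb addbN.
Qed.

Lemma position_parity_notin b s x : x \notin s -> position_parity b s x = false.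
Proof.
elim: s b => //= y s IH b; rewrite inE negb_or eq_sym => /andP[/negbTE-> xs].
by rewrite IH.
Qed.

Lemma odd_count_sum (s : seq nat) (P : pred nat) (f : nat -> nat) :
  {in s, forall y, P y = odd (f y)} -> odd (count P s) = odd (\sum_(y <- s) f y).
Proof.
elim: s => [|y s IH] Pf; first by rewrite big_nil.
rewrite big_cons /= !oddD IH => [|z zs]; last by apply: Pf; rewrite inE zs orbT.
by rewrite -Pf ?mem_head //; case: (P y).
Qed.

(** An arrow linked with [x] has exactly one endpoint between those of [x], any
    other arrow has none or two. *)
Lemma odd_arrowE (w : word bool) x : is_gauss w -> x \in arrows w ->
  odd_arrow w x = ~~ position_parity false (map (@arrow bool) w) x.
Proof.
move=> gw xw; have c2 := gauss_count gw xw.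
set s := map _ w in c2 *.
have [u [v [t [sE [xu xv xt]]]]] : exists u v t,
    s = u ++ x :: v ++ x :: t /\ [/\ x \notin u, x \notin v & x \notin t].
  have xs : x \in s by rewrite -mem_arrows.
  have [u [r E]] := mem_split xs; rewrite E count_cat /= eqxx /= in c2.
  have [xu|xu] := boolP (x \in u).
    have [u1 [u2 E1]] := mem_split xu; rewrite E1 count_cat /= eqxx /= in c2.
    exists u1, u2, r; rewrite E E1 -catA; split=> //; split; apply/count_memPn;
      move: c2; move: (count_mem x u1) (count_mem x u2) (count_mem x r); lia.
  have xr : x \in r.
    by apply: contraT => /count_memPn xr; move/count_memPn: xu c2; rewrite xr => ->.
  have [r1 [r2 E1]] := mem_split xr; rewrite E1 count_cat /= eqxx /= in c2.
  exists u, r1, r2; rewrite E E1; split=> //; split; apply/count_memPn;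
    move: c2; move: (count_mem x u) (count_mem x r1) (count_mem x r2); lia.
have par : position_parity false s x = ~~ odd (size v).
  rewrite sE position_parity_cat position_parity_notin //= eqxx position_parity_cat.
  rewrite position_parity_notin //= eqxx position_parity_notin //.
  by case: (odd (size u)); case: (odd (size v)).
rewrite par negbK /odd_arrow.
rewrite (@odd_count_sum _ _ (fun y => count_mem y v)) => [|y yw].
  rewrite -size_count ?uniq_arrows // => y yv.
  by rewrite mem_arrows -/s sE mem_cat inE mem_cat yv !orbT.
rewrite /linked -/s; case: (eqVneq x y) => [<-|xy] /=; first by move/count_memPn: xv => ->.
have fil q : x \notin q ->
    filter (fun z => (z == x) || (z == y)) q = nseq (count_mem y q) y.
  elim: q => //= z q IH; rewrite inE negb_or eq_sym => /andP[/negbTE-> /IH->] /=.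
  by case: eqP => [->|].
have := gauss_count gw yw; rewrite -/s sE filter_cat /= eqxx filter_cat /= eqxx.
rewrite !fil // count_cat /= count_cat /= (negbTE xy).
have /negbTE yx : y != x by rewrite eq_sym.
case: (count_mem y u) => [|[|[|?]]]; case: (count_mem y v) => [|[|[|?]]];
  case: (count_mem y t) => [|[|[|?]]] //= _; rewrite ?eqseq_cons ?eqxx ?yx ?(negbTE xy) ?andbF //=.
Qed.

Definition even_arrow (w : word bool) (x : nat) : bool :=
  position_parity false (map (@arrow bool) w) x.

Lemma delete_oddE w : is_gauss w -> delete_odd w = subdiagram (even_arrow w) w.
Proof.
by move=> gw; apply: eq_subdiagram_in => x xw; rewrite odd_arrowE // negbK.
Qed.

Lemma gauss_delete_odd w : is_gauss w -> is_gauss (delete_odd w).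
Proof. exact: gauss_subdiagram. Qed.

Lemma gauss_iter m w : is_gauss w -> is_gauss (iter m delete_odd w).
Proof. by move=> gw; elim: m => //= m; apply: gauss_delete_odd. Qed.

(** The moves on words, renaming included. *)
Definition move_word (w v : word bool) : Prop :=
  [\/ iso w v, omega1 w v, omega2 w v | omega3 w v].

Lemma undup_map_in (g : nat -> nat) s : {in s &, injective g} ->
  undup (map g s) = map g (undup s).
Proof.
elim: s => //= x s IH gi; rewrite IH; last first.
  by move=> y z ys zs; apply: gi; rewrite inE ?ys ?zs orbT.
have -> : (g x \in map g s) = (x \in s).
  apply/mapP/idP => [[y ys /gi->]|xs]; rewrite ?mem_head ?inE ?ys ?orbT //.
  by exists x.
by case: ifP.
Qed.

Lemma index_map_in (g : nat -> nat) s x : {in s &, injective g} -> x \in s ->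
  index (g x) (map g s) = index x s.
Proof.
elim: s => //= y s IH gi; rewrite inE => xs.
rewrite (inj_in_eq gi) ?mem_head ?inE //; case: eqP => // yx.
move: xs => /predU1P[xy|xs]; first by case: yx.
by rewrite IH // => z t zs ts; apply: gi; rewrite inE ?zs ?ts orbT.
Qed.

Lemma normal_of_rename (g : nat -> nat) (w : word bool) :
  {in arrows w &, injective g} -> normal (rename g w) = normal w.
Proof.
move=> gi; have gi' : {in map (@arrow bool) w &, injective g}.
  by move=> x y; rewrite -!mem_arrows; apply: gi.
rewrite /normal /rename -map_comp; apply/eq_in_map => e ew /=; congr (_, _, _).
rewrite {1}/arrow /= {1}/arrows -map_comp.
rewrite (map_comp g (@arrow bool)) undup_map_in // index_map_in ?arrows_mem //.
Qed.

Lemma position_parity_map (g : nat -> nat) b s x : {in x :: s &, injective g} ->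
  position_parity b (map g s) (g x) = position_parity b s x.
Proof.
elim: s b => //= y s IH b gi; rewrite (inj_in_eq gi) ?inE ?eqxx ?orbT // IH //.
by move=> z t; rewrite !inE => zs ts; apply: gi; rewrite !inE;
  [case/orP: zs => -> | case/orP: ts => ->]; rewrite ?orbT.
Qed.

Lemma delete_odd_rename (g : nat -> nat) (w : word bool) :
  {in arrows w &, injective g} -> is_gauss w ->
  delete_odd (rename g w) = rename g (delete_odd w).
Proof.
move=> gi gw; rewrite !delete_oddE ?gauss_rename // /subdiagram filter_map; congr map.
apply: eq_in_filter => e ew /=; rewrite /even_arrow -map_comp.
rewrite -[LHS]/(position_parity false (map (g \o @arrow bool) w) (g (arrow e))).
rewrite map_comp position_parity_map // => x y.
by rewrite !inE -!mem_arrows => /predU1P[->|xw] /predU1P[->|yw]; apply: gi; rewrite ?arrows_mem.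
Qed.

Lemma iso_delete_odd w v : is_gauss w -> is_gauss v ->
  iso w v -> iso (delete_odd w) (delete_odd v).
Proof.
have E u : is_gauss u -> normal (delete_odd (normal u)) = normal (delete_odd u).
  move=> gu; rewrite (normal_rename u) delete_odd_rename ?normal_of_rename //;
    last exact: index_inj_arrows.
  by move=> x y; rewrite !mem_arrows_subdiagram => /andP[_ xu] /andP[_ yu];
    apply: index_inj_arrows.
by move=> gw gv /eqP wv; apply/eqP; rewrite -E // wv E.
Qed.

(** The positions of the isolated arrow are consecutive, hence it is even; all other
    positions are shifted by 0 or 2. *)
Lemma omega1_delete_odd w v : is_gauss v -> omega1 w v ->
  omega1 (delete_odd w) (delete_odd v).
Proof.
move=> + wv; case: wv => u0 u1 e; set v' := _ ++ _ => gv.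
have pv : perm_eq v' ([:: e; mirror e] ++ u0 ++ u1) by rewrite perm_catCA.
have ge : is_gauss [:: e; mirror e].
  by rewrite /is_gauss /= !inE !eqxx mirrorK eqxx !orbT.
have dx d : d \in u0 ++ u1 -> arrow d != arrow e.
  move=> du; apply: (gauss_cat_disjoint ge _ (mem_head _ _) du).
  by rewrite -(perm_gauss pv).
have gw : is_gauss (u0 ++ u1).
  pose P x := x != arrow e.
  have <- : subdiagram P (u0 ++ u1) = u0 ++ u1 by apply/all_filterP/allP.
  have <- : subdiagram P v' = subdiagram P (u0 ++ u1).
    by rewrite !subdiagram_cat /= /P arrow_mirror eqxx.
  exact: gauss_subdiagram.
rewrite !delete_oddE // {2}/v' !subdiagram_cat.
have notin u : {subset u <= u0 ++ u1} -> arrow e \notin map (@arrow bool) u.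
  by move=> uu; apply/mapP => -[d /uu/dx/negP de E]; case: de; rewrite E.
have same x : x != arrow e -> even_arrow v' x = even_arrow (u0 ++ u1) x.
  move=> /negbTE xe; rewrite /even_arrow /v' !map_cat !position_parity_cat /=.
  by rewrite arrow_mirror !(eq_sym (arrow e)) xe /= ?negbK ?addbF.
have self : even_arrow v' (arrow e).
  rewrite /even_arrow /v' !map_cat !position_parity_cat /= arrow_mirror !eqxx.
  rewrite !position_parity_notin ?notin //; try by move=> d du; rewrite mem_cat du ?orbT.
  by case: (odd _).
have -> : subdiagram (even_arrow v') [:: e; mirror e] = [:: e; mirror e].
  by rewrite /= arrow_mirror self.
have sub u : {subset u <= u0 ++ u1} ->
    subdiagram (even_arrow v') u = subdiagram (even_arrow (u0 ++ u1)) u.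
  by move=> uu; apply: eq_in_filter => d /uu/dx; apply: same.
rewrite !sub; try by move=> d du; rewrite mem_cat du ?orbT.
exact: Omega1.
Qed.

(** The two arrows have the same parity: both are deleted, or none. *)
Lemma omega2_delete_odd w v : is_gauss w -> is_gauss v -> omega2 w v ->
  delete_odd v = delete_odd w \/ omega2 (delete_odd w) (delete_odd v).
Proof.
move=> + + wv; case: wv => u0 u1 u2 B1 B2 x y h s.
set X := (x, h, s); set Y := (y, h, ~~ s) => pB1 pB2.
set w' := _ ++ _ => gw; set v' := _ ++ _ => gv.
have pv : perm_eq v' ([:: X; Y; mirror X; mirror Y] ++ w').
  apply/permP => a; rewrite /v' /w' !count_cat (permP pB1) (permP pB2).
  by rewrite /X /Y /mirror /arrow /is_head /deco /=; lia.
have [uv _ iv] := gaussP _ gv.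
have xy : x != y.
  apply: contraTneq uv => xy; rewrite (perm_uniq pv) /=.
  apply/negP => /and4P[nX nY _ _].
  have : Y = X \/ Y = mirror X.
    by apply: iv; rewrite ?(perm_mem pv) ?inE ?eqxx ?orbT //= xy.
  by rewrite /X /Y; case=> -[]; case: (s) (h) => -[].
have yx := xy; rewrite eq_sym in yx.
have dB d : d \in w' -> arrow d != x /\ arrow d != y.
  move=> dw; have gv' : is_gauss (w' ++ [:: X; Y; mirror X; mirror Y]).
    by rewrite -(perm_gauss (_ : perm_eq v' _)) // (permPl pv) perm_catC.
  split; [rewrite -[x]/(arrow X) | rewrite -[y]/(arrow Y)]; rewrite eq_sym;
    by apply: (gauss_cat_disjoint gw gv' dw); rewrite !inE eqxx ?orbT.
have notin u : {subset u <= w'} ->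
    (x \notin map (@arrow bool) u) * (y \notin map (@arrow bool) u).
  by move=> uw; split; apply/mapP => -[d /uw/dB[/negP dx /negP dy] E];
    [case: dx | case: dy]; rewrite E.
have s0 : {subset u0 <= w'} by move=> d du; rewrite mem_cat du.
have s1 : {subset u1 <= w'} by move=> d du; rewrite !mem_cat du orbT.
have s2 : {subset u2 <= w'} by move=> d du; rewrite !mem_cat du !orbT.
have same z : z != x -> z != y -> even_arrow v' z = even_arrow w' z.
  move=> /negbTE zx /negbTE zy; rewrite /even_arrow /v' /w' !map_cat !position_parity_cat.
  by case: (perm_eq2 pB1) => ->; case: (perm_eq2 pB2) => ->;
    rewrite /= /arrow /= !(eq_sym _ z) ?zx ?zy /= ?negbK ?addbF ?addFb.
have both : even_arrow v' x = even_arrow v' y.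
  rewrite /even_arrow /v' !map_cat !position_parity_cat.
  rewrite !(position_parity_notin _ (notin _ s0).1, position_parity_notin _ (notin _ s0).2).
  rewrite !(position_parity_notin _ (notin _ s1).1, position_parity_notin _ (notin _ s1).2).
  rewrite !(position_parity_notin _ (notin _ s2).1, position_parity_notin _ (notin _ s2).2).
  by case: (perm_eq2 pB1) => ->; case: (perm_eq2 pB2) => ->;
    rewrite /= /arrow /= !eqxx ?(negbTE xy) ?(negbTE yx) /=;
    case: (odd (size (map _ u0))); case: (odd (size (map _ u1))).
have sub u : {subset u <= w'} -> subdiagram (even_arrow v') u = subdiagram (even_arrow w') u.
  by move=> uw; apply: eq_in_filter => d /uw/dB[]; apply: same.
rewrite !delete_oddE // {2 4}/v' !subdiagram_cat !(sub _ s0, sub _ s1, sub _ s2).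
case ex : (even_arrow v' x); [right | left].
  have -> : subdiagram (even_arrow v') B1 = B1.
    by apply/all_filterP; rewrite (perm_all _ pB1) /= /arrow /= -both ex.
  have -> : subdiagram (even_arrow v') B2 = B2.
    by apply/all_filterP; rewrite (perm_all _ pB2) /= /arrow /= -both ex.
  exact: Omega2 pB1 pB2.
have none B h' : perm_eq B [:: (x, h', s); (y, h', ~~ s)] -> subdiagram (even_arrow v') B = [::].
  by case/perm_eq2=> ->; rewrite /= /arrow /= -both ex.
by rewrite (none _ _ pB1) (none _ _ pB2).
Qed.

(** Every endpoint moves by one position. *)
Lemma position_parity_rev2 (b : bool) (B : word bool) x : size B = 2 ->
  position_parity b (map (@arrow bool) (rev B)) x
  = position_parity b (map (@arrow bool) B) x (+) odd (count_mem x (map (@arrow bool) B)).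
Proof.
case: B => [|d [|e [|]]] //= _.
by case: (arrow d == x); case: (arrow e == x); case: b.
Qed.

(** Each arrow has its endpoints in two of the three intervals, so its parity is
    unchanged.  The number of odd arrows among the three of an Omega3 move is even: the
    parities of the positions in two consecutive places differ, and there are
    three pairs of these.  If two arrows are deleted, reversing the intervals does
    nothing. *)
Lemma omega3_delete_odd w v : is_gauss w -> is_gauss v -> omega3 w v ->
  delete_odd v = delete_odd w \/ omega3 (delete_odd w) (delete_odd v).
Proof.
move=> + + wv; case: wv => u0 u1 u2 u3 B1 B2 B3 a b c s pB.
set w' := _ ++ _ => gw; set v' := _ ++ _ => gv.
have : all (fun B => size B == 2) [:: B1; B2; B3] by rewrite (perm_all _ pB).
case/and4P=> /eqP z1 /eqP z2 /eqP z3 _.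
have same : even_arrow v' =1 even_arrow w'.
  move=> x; rewrite /even_arrow /v' /w' !map_cat !position_parity_cat !size_map !size_rev.
  rewrite !position_parity_rev2 //.
  have : odd (count_mem x (map (@arrow bool) (flatten [:: B1; B2; B3]))) = false.
    have := perm_map (@arrow bool) (perm_flatten pB).
    move/permP->; rewrite /= /arrow /=.
    by case: (a == x); case: (b == x); case: (c == x).
  rewrite /= cats0 !map_cat !count_cat !oddD.
  move: (odd _) (odd _) (odd _) => o1 o2 o3.
  move: (position_parity _ (map _ u0) _) (position_parity _ (map _ u1) _)
    (position_parity _ (map _ u2) _) (position_parity _ (map _ u3) _) => p0 p1 p2 p3.
  move: (position_parity _ (map _ B1) _) (position_parity _ (map _ B2) _)
    (position_parity _ (map _ B3) _) => q1 q2 q3.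
  by case: o1 o2 o3 => [] [] [] //= _; rewrite ?addbF // !(addbT, addbN, addNb) ?negbK.
have sub u : subdiagram (even_arrow v') u = subdiagram (even_arrow w') u.
  by apply: eq_filter => e; rewrite same.
rewrite !delete_oddE // {2 4}/v' {2 4}/w'.

have wp : perm_eq w' (flatten [:: B1; B2; B3] ++ u0 ++ u1 ++ u2 ++ u3).
  by apply/permP => z; rewrite /w' /= cats0 !count_cat; lia.
have uK : uniq (flatten [:: B1; B2; B3]).
  by case/gaussP: gw => uw _ _; move: uw; rewrite (perm_uniq wp) cat_uniq => /and3P[].
rewrite (perm_uniq (perm_flatten pB)) in uK.
have [ab ac bc] : [/\ a != b, a != c & b != c].
  by split; apply: contraTneq uK => E; rewrite E /= !inE !eqxx ?orbT ?andbF.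
have [ba ca cb] : [/\ b != a, c != a & c != b] by split; rewrite eq_sym.
have gK : is_gauss (flatten [:: B1; B2; B3]).
  rewrite (perm_gauss (perm_flatten pB)) /is_gauss /mirror /arrow /is_head /deco /= !inE.
  by rewrite !eqxx (negbTE ab) (negbTE ac) (negbTE bc) (negbTE ba) (negbTE ca) (negbTE cb) ?orbT.
have out x : x \in [:: a; b; c] -> forall u, {subset u <= u0 ++ u1 ++ u2 ++ u3} ->
    x \notin map (@arrow bool) u.
  move=> xa u uu; apply/mapP => -[d /uu du E].
  have [e eK ex] : exists2 e, e \in flatten [:: B1; B2; B3] & arrow e = x.
    move: xa; rewrite !inE => /or3P[]/eqP->;
      [exists (a, false, s) | exists (b, false, s) | exists (c, false, s)] => //;
      by rewrite (perm_mem (perm_flatten pB)) !inE eqxx ?orbT.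
  have := gauss_cat_disjoint gK _ eK du; rewrite -(perm_gauss wp) => /(_ gw).
  by rewrite ex E eqxx.
(* Parity of the number of even arrows of the triangle. *)
pose three (f : nat -> bool) := f a (+) (f b (+) f c).
have blocks : all (fun B => all (fun o => three (position_parity o (map (@arrow bool) B)))
    [:: false; true]) [:: B1; B2; B3].
  rewrite (perm_all _ pB) /three /= /arrow /= !eqxx.
  by rewrite (negbTE ab) (negbTE ac) (negbTE bc) (negbTE ba) (negbTE ca) (negbTE cb).
have blk B o : B \in [:: B1; B2; B3] -> three (position_parity o (map (@arrow bool) B)).
  by move=> /(allP blocks)/allP; apply; case: o.
have threeP : three (even_arrow w').
  have s0 : {subset u0 <= u0 ++ u1 ++ u2 ++ u3} by move=> d du; rewrite !mem_cat du.
  have s1 : {subset u1 <= u0 ++ u1 ++ u2 ++ u3} by move=> d du; rewrite !mem_cat du !orbT.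
  have s2 : {subset u2 <= u0 ++ u1 ++ u2 ++ u3} by move=> d du; rewrite !mem_cat du !orbT.
  have s3 : {subset u3 <= u0 ++ u1 ++ u2 ++ u3} by move=> d du; rewrite !mem_cat du !orbT.
  have E x : x \in [:: a; b; c] -> exists o1 o2 o3, forall z, z \in [:: a; b; c] ->
      even_arrow w' z = position_parity o1 (map (@arrow bool) B1) z
        (+) (position_parity o2 (map (@arrow bool) B2) z
        (+) position_parity o3 (map (@arrow bool) B3) z).
    move=> _; do 3 eexists; move=> z za.
    rewrite /even_arrow /w' !map_cat !position_parity_cat.
    rewrite (position_parity_notin _ (out z za _ s0)) (position_parity_notin _ (out z za _ s1)).
    rewrite (position_parity_notin _ (out z za _ s2)) (position_parity_notin _ (out z za _ s3)).
    by rewrite !addFb addbF; reflexivity.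
  have [o1 [o2 [o3 Ez]]] := E a (mem_head _ _).
  rewrite /three !Ez ?inE ?eqxx ?orbT //.
  have := blk B1 o1 (mem_head _ _); have := blk B2 o2; have := blk B3 o3.
  rewrite /three !inE !eqxx !orbT => /(_ isT) + /(_ isT).
  by do 3 (move: (position_parity _ (map _ B1) _) => [];
           move: (position_parity _ (map _ B2) _) => [];
           move: (position_parity _ (map _ B3) _) => []).
rewrite !subdiagram_cat /= !sub.
set f := subdiagram (even_arrow w').
have frev B : f (rev B) = rev (f B) by rewrite /f /subdiagram filter_rev.
rewrite /= !frev.
case: (boolP (all (even_arrow w') [:: a; b; c])) => [/and4P[Pa Pb Pc _]|notall].
  right; have fB B : B \in [:: B1; B2; B3] -> f B = B.
    rewrite (perm_mem pB) => BX; apply/all_filterP; move: B BX; apply/allP.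
    by rewrite /= /arrow /= Pa Pb Pc.
  by rewrite (fB B1) ?(fB B2) ?(fB B3) ?inE ?eqxx ?orbT //; exact: (Omega3 (f u0) (f u1) (f u2) (f u3) pB).
left; have small B : B \in [:: B1; B2; B3] -> rev (f B) = f B.
  move=> BX; suff : size (f B) <= 1 by case: (f B) => [|? []].
  move: BX; rewrite (perm_mem pB); move: B; apply/allP.
  move: threeP notall; rewrite /three /= /f /subdiagram /= /arrow /=.
  by case: (even_arrow w' a); case: (even_arrow w' b); case: (even_arrow w' c).
by rewrite (small B1) ?(small B2) ?(small B3) ?inE ?eqxx ?orbT.
Qed.

Lemma move_delete_odd w v : is_gauss w -> is_gauss v -> move_word w v ->
  move_word (delete_odd w) (delete_odd v).
Proof.
have refl (u u' : word bool) : u' = u -> move_word u u' by move=> ->; constructor 1; rewrite /iso.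
move=> gw gv [wv|wv|wv|wv].
- by constructor 1; apply: iso_delete_odd.
- by constructor 2; apply: omega1_delete_odd.
- by case: (omega2_delete_odd gw gv wv) => [/refl|]; last constructor 3.
- by case: (omega3_delete_odd gw gv wv) => [/refl|]; last constructor 4.
Qed.

Lemma move_coef N w v : is_gauss w -> is_gauss v -> move_word w v -> coef N w = coef N v.
Proof.
move=> gw gv [wv|wv|wv|wv].
- exact: coef_iso.
- by case: wv gv => u0 u1 e gv; rewrite coef_omega1.
- by rewrite (coef_omega2 N gv wv).
- exact: coef_omega3.
Qed.

Lemma equivalent_coef N m (D E : gauss_diagram) : equivalent D E ->
  coef N (iter m delete_odd D) = coef N (iter m delete_odd E).
Proof.
elim=> // {D E} [D E DE|D F E _ -> _ ->] //.
have {}DE : move_word D E by case: DE => ?; [constructor 1|constructor 2|constructor 3|constructor 4].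
apply: move_coef; rewrite ?gauss_iter ?code_gauss //.
elim: m => //= m IH; apply: move_delete_odd => //; rewrite gauss_iter ?code_gauss //.
Qed.

Local Open Scope ring_scope.

(** * The labelled pairings in terms of unlabelled coefficients *)

Lemma big_tuple_cons (n : nat) (F : seq bool -> int) :
  \sum_(t : n.+1.-tuple bool) F t
  = \sum_(t : n.-tuple bool) F (false :: t) + \sum_(t : n.-tuple bool) F (true :: t).
Proof.
rewrite (reindex (fun p : bool * n.-tuple bool => [tuple of p.1 :: p.2])) /=; last first.
  exists (fun t => (thead t, [tuple of behead t])) => [[b t] _|t _].
    by congr (_, _); apply: val_inj.
  by rewrite [RHS]tuple_eta; apply: val_inj.
rewrite -(pair_bigA _ (fun b (t : n.-tuple bool) => F (b :: t))) /=.
by rewrite big_bool addrC.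
Qed.

Lemma sum_masks (s : seq nat) (F : seq nat -> int) :
  \sum_(t : (size s).-tuple bool) F (mask t s) = \sum_(A <- subsets s) F A.
Proof.
elim: s F => [|x s IH] F.
  rewrite (big_pred1 [tuple]) ?big_seq1 // => t.
  by rewrite /= tuple0; apply/esym/eqP.
rewrite (big_tuple_cons _ (fun t => F (mask t (x :: s)))) big_subsets_cons /=.
by rewrite -(IH F) -(IH (F \o cons x)).
Qed.

Lemma sum_I_sum (L : word labelled) (G : int * word labelled -> int) :
  \sum_(b <- I_sum L) G b
  = \sum_(A <- subsets (arrows L)) G (1, subdiagram (mem A) L).
Proof.
rewrite /I_sum big_image /= -(sum_masks _ (fun A => G (1, subdiagram (mem A) L))).
exact: eq_bigl.
Qed.

Lemma arrows_put_labels g w : arrows (put_labels g w) = arrows w.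
Proof. by rewrite /arrows /put_labels -map_comp. Qed.

Lemma subdiagram_put_labels A g w :
  subdiagram A (put_labels g w) = put_labels g (subdiagram A w).
Proof. by rewrite /subdiagram /put_labels filter_map. Qed.

(** A normal word has its arrows named 0, 1, ... already, so an isomorphism is the
    canonical renaming and carries the labels along it. *)
Lemma iso_put_labels g h (w v : word bool) : normal w = w ->
  iso (put_labels g w) (put_labels h v)
  = (w == normal v) && all (fun x => g (index x (arrows v)) == h x) (arrows v).
Proof.
move=> nw; have -> : all (fun x => g (index x (arrows v)) == h x) (arrows v)
    = all (fun e => g (index (arrow e) (arrows v)) == h (arrow e)) v.
  apply/allP/allP => H; first by move=> e /arrows_mem/H.
  by move=> x; rewrite mem_arrows => /mapP[e /H ? ->].
have normal_put f u : normal (put_labels f u)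
    = [seq (index (arrow e) (arrows u), is_head e, (deco e, f (arrow e))) | e <- u].
  by rewrite /normal arrows_put_labels /put_labels -map_comp.
have put_normal : normal (put_labels g w) = put_labels g w.
  rewrite normal_put; apply/eq_in_map => e ew; congr (_, _, _).
  have := nw; rewrite /normal -[RHS]map_id => /eq_in_map/(_ e ew).
  by move/(congr1 (@arrow bool)).
rewrite /iso put_normal normal_put.
apply/eqP/andP => [E|[/eqP-> /allP H]].
  have wE : w = normal v.
    have := congr1 (map (fun z : letter labelled => (arrow z, is_head z, (deco z).1))) E.
    rewrite /put_labels -!map_comp => E'; apply: etrans E'.
    by rewrite -[LHS]map_id; apply: eq_map => -[[]].
  split; first exact/eqP.
  have := congr1 (map (fun z : letter labelled => (deco z).2)) E.
  rewrite /put_labels wE -!map_comp => /eq_in_map H.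
  by apply/allP => e /H /= <-.
rewrite /put_labels /normal -map_comp; apply/eq_in_map => e /H /eqP /= <-.
by [].
Qed.

Lemma sum_delta (T : eqType) (s : seq T) (u : T) (F : T -> int) : uniq s ->
  \sum_(w <- s) (if w == u then F w else 0) = if u \in s then F u else 0.
Proof.
move=> us; case: ifP => [uin|unin].
  by rewrite (bigD1_seq u) //= eqxx big1 ?addr0 // => w /negbTE->.
by rewrite big1_seq // => w /andP[_ ws]; case: eqP ws => // ->; rewrite unin.
Qed.

Lemma normal_normal (w : word bool) : normal (normal w) = normal w.
Proof. by rewrite (normal_rename w) normal_of_rename //; apply: index_inj_arrows. Qed.

Lemma gauss_normal (w : word bool) : is_gauss w -> is_gauss (normal w).
Proof. exact: gauss_rename (@index_inj_arrows _ w). Qed.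

Lemma uniq_conway_diagrams N : uniq (conway_diagrams N).
Proof.
rewrite !filter_uniq // map_inj_uniq ?enum_uniq // => t1 t2.
move/inj_map => H; apply/val_inj/H => -[[i1 h1] s1] [[i2 h2] s2] /= [/val_inj-> -> ->].
by [].
Qed.

Lemma normal_conway_diagrams N w : w \in conway_diagrams N -> normal w = w.
Proof. by rewrite !mem_filter => /andP[_ /andP[/andP[_ /eqP]]]. Qed.

Lemma mem_conway_diagrams N (v : word bool) : is_gauss v ->
  (normal v \in conway_diagrams N) = (size v == N.*2)%N && conway v.
Proof.
move=> gv.
have -> : conway v = conway (normal v).
  by rewrite normal_rename conway_rename //; apply: index_inj_arrows.
rewrite !mem_filter gauss_normal // normal_normal eqxx /= andbC; congr (_ && _).
apply/mapP/eqP => [[t _ /(congr1 size)]|sv]; first by rewrite !size_map size_tuple.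
have sa : size (arrows v) = N by apply: double_inj; rewrite -size_gauss // sv.
have bound : all (fun e : letter bool => (arrow e < N)%N) (normal v).
  by apply/allP => _ /mapP[e /arrows_mem ev ->]; rewrite -sa /arrow /= index_mem.
have [t tE] : exists t : seq ('I_N * bool * bool),
    [seq (val e.1.1, e.1.2, e.2) | e <- t] = normal v.
  elim: (normal v) bound => [|[[i h] s] u IH] /=; first by exists [::].
  by case/andP=> iN /IH[t <-]; exists ((Ordinal iN, h, s) :: t).
have st : size t == N.*2 by rewrite -(size_map (fun e : 'I_N * bool * bool => (val e.1.1, e.1.2, e.2))) tE size_map sv.
by exists (Tuple st); rewrite ?mem_enum.
Qed.

(** The listed Conway diagrams are normal words, so only the normal form of [v] can
    be isomorphic to [v]. *)
Lemma sum_conway_diagrams N (v : word bool) (K : int) : is_gauss v ->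
  \sum_(w <- conway_diagrams N) (if w == normal v then weight w * K else 0)
  = term N v * K.
Proof.
move=> gv; rewrite sum_delta ?uniq_conway_diagrams // mem_conway_diagrams //.
by rewrite /term normal_rename weight_rename; case: ifP; rewrite ?mul0r.
Qed.

Lemma pairing_even N (w : word bool) (h : nat -> enat) : is_gauss w ->
  pairing (C_even N None) (I_sum (put_labels h w))
  = \sum_(A <- subsets (arrows w) | all (fun x => h x == None) A)
      term N (subdiagram (mem A) w).
Proof.
move=> gw; rewrite /pairing /C_even big_map /=.
under eq_bigr => v _ do rewrite sum_I_sum /=.
rewrite exchange_big /= arrows_put_labels [RHS]big_mkcond; apply: eq_big_seq => A As.
set v := subdiagram (mem A) w; have gv : is_gauss v by apply: gauss_subdiagram.
have hA : all (fun x => h x == None) (arrows v) = all (fun x => h x == None) A.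
  apply: eq_all_r => x; rewrite mem_arrows_subdiagram /=.
  by case xA: (x \in A) => //=; apply: (subsets_sub As).
rewrite subdiagram_put_labels -/v.
transitivity (term N v * (all (fun x => h x == None) A)%:R); last first.
  by case: all; rewrite ?mulr1 ?mulr0.
rewrite -sum_conway_diagrams //; apply: eq_big_seq => u /normal_conway_diagrams nu.
rewrite mulr1 iso_put_labels // -hA.
rewrite (eq_all (a2 := fun x => h x == None)) => [|x]; last by rewrite eq_sym.
by case: eqP => //= _; rewrite mulr0.
Qed.

(** A labelling by 1, ..., m+1 is matched by exactly one labelling of a Conway
    diagram, which the odd formula contains unless it is constant. *)
Lemma sum_odd_labellings N m (s : seq nat) (h : nat -> enat) : uniq s -> size s = N ->
  {in s, forall x, exists2 j, h x = Some j.+1 & (j <= m)%N} ->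
  \sum_(g <- odd_labellings N m) ((all (fun x => label_of g (index x s) == h x) s)%:R : int)
  = (~~ all (fun x => h x == Some m.+1) s)%:R.
Proof.
move=> us sN hs; pose g0 := [ffun i : 'I_N => inord (odflt 0%N (h (nth 0%N s i))).-1 : 'I_m.+1].
have g0E (i : 'I_N) : h (nth 0%N s i) = Some (nat_of_ord (g0 i)).+1.
  have /hs[j hj jm] : nth 0%N s i \in s by rewrite mem_nth ?sN.
  by rewrite ffunE hj /= inordK.
have labE g (i : 'I_N) : label_of g (index (nth 0%N s i) s) = Some (nat_of_ord (g i)).+1.
  by rewrite index_uniq ?sN // /label_of valK.
have ordP (P : pred nat) : all P s = [forall i : 'I_N, P (nth 0%N s i)].
  apply/(all_nthP 0%N)/forallP => [H i|H i]; first by apply: H; rewrite sN.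
  by rewrite sN => iN; apply: (H (Ordinal iN)).
transitivity (\sum_(g <- odd_labellings N m) (if g == g0 then 1 else 0 : int)).
  apply: eq_bigr => g _; rewrite ordP.
  have -> : [forall i : 'I_N, label_of g (index (nth 0%N s i) s) == h (nth 0%N s i)] = (g == g0).
    apply/forallP/eqP => [H|-> i]; last by rewrite labE g0E.
    apply/ffunP => i; apply: val_inj; have := H i.
    by rewrite labE g0E => /eqP[].
  by case: eqP.
have uL : uniq (odd_labellings N m) by apply: filter_uniq; exact: enum_uniq.
have mL : (g0 \in odd_labellings N m) = ~~ [forall i, g0 i == ord_max].
  by apply: etrans (mem_filter _ _ _) _; rewrite mem_enum andbT.
rewrite (sum_delta _ _ uL) mL ordP.
have -> : [forall i, g0 i == ord_max]
        = [forall i : 'I_N, h (nth 0%N s i) == Some m.+1].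
  apply: eq_forallb => i; rewrite g0E; apply/eqP/eqP => [->//|[E]].
  exact: val_inj.
by case: (~~ _).
Qed.

Lemma pairing_odd N m (w : word bool) (h : nat -> enat) : is_gauss w ->
  {in arrows w, forall x, exists2 j, h x = Some j.+1 & (j <= m)%N} ->
  pairing (C_odd N m) (I_sum (put_labels h w))
  = \sum_(A <- subsets (arrows w) | ~~ all (fun x => h x == Some m.+1) A)
      term N (subdiagram (mem A) w).
Proof.
move=> gw hw; rewrite /pairing /C_odd big_allpairs_dep /=.
under eq_bigr => v _ do under eq_bigr => g _ do rewrite sum_I_sum /=.
under eq_bigr => v _ do rewrite exchange_big /=.
rewrite exchange_big /= arrows_put_labels [RHS]big_mkcond; apply: eq_big_seq => A As.
set v := subdiagram (mem A) w; have gv : is_gauss v by apply: gauss_subdiagram.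
have hA : all (fun x => h x == Some m.+1) (arrows v) = all (fun x => h x == Some m.+1) A.
  apply: eq_all_r => x; rewrite mem_arrows_subdiagram /=.
  by case xA: (x \in A) => //=; apply: (subsets_sub As).
rewrite subdiagram_put_labels -/v.
pose K : int := \sum_(g <- odd_labellings N m)
  (all (fun x => label_of g (index x (arrows v)) == h x) (arrows v))%:R.
transitivity (term N v * K).
  rewrite -sum_conway_diagrams //; apply: eq_big_seq => u /normal_conway_diagrams nu.
  case: (eqVneq u (normal v)) => uv; last first.
    by rewrite big1 // => g _; rewrite iso_put_labels // (negbTE uv) mulr0.
  rewrite /K big_distrr; apply: eq_bigr => g _.
  by rewrite mulr1 iso_put_labels // uv eqxx.
have [sv|sv] := eqVneq (size v) N.*2; last by rewrite /term (negbTE sv) mul0r if_same.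
rewrite /K sum_odd_labellings ?uniq_arrows ?hA //.
- by case: all; rewrite ?mulr0 ?mulr1.
- by apply: double_inj; rewrite -size_gauss.
by move=> x; rewrite mem_arrows_subdiagram => /andP[_]; apply: hw.
Qed.

Lemma arrows_iter i j (w : word bool) : (i <= j)%N ->
  {subset arrows (iter j delete_odd w) <= arrows (iter i delete_odd w)}.
Proof.
move=> /subnK <-; elim: (j - i)%N => //= k IH x.
by rewrite /delete_odd mem_arrows_subdiagram => /andP[_]; apply: IH.
Qed.

Lemma iter_subdiagram m (w : word bool) :
  iter m delete_odd w = subdiagram (mem (arrows (iter m delete_odd w))) w.
Proof.
elim: m => [|m IH].
  by apply/esym/all_filterP/allP => e; apply: arrows_mem.
rewrite iterS {1}/delete_odd {2}IH subdiagram_comp; apply: eq_subdiagram_in => x xw.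
rewrite /delete_odd /= mem_arrows_subdiagram.
by [].
Qed.

(** Deletions never bring an arrow back, hence an arrow of the last diagram has not
    been deleted before. *)
Lemma flabel_head (w : word bool) b x : x \in arrows w ->
  let L := [seq i <- iota 1 b | x \notin arrows (iter i delete_odd w)] in
  if x \in arrows (iter b delete_odd w) then L = [::]
  else exists i L', [/\ (1 <= i)%N, (i <= b)%N & L = i :: L'].
Proof.
move=> xw L; case: ifP => xb.
  rewrite /L (eq_in_filter (a2 := pred0)) ?filter_pred0 // => i.
  rewrite mem_iota => /andP[_ ib]; apply/negbF; apply: arrows_iter xb.
  by rewrite -ltnS -add1n.
have b0 : (0 < b)%N by case: b xb {L} => //=; rewrite xw.
have : b \in [seq i <- iota 1 b | x \notin arrows (iter i delete_odd w)].
  by rewrite mem_filter xb mem_iota b0 add1n ltnS leqnn.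
rewrite /L; case E : [seq i <- _ | _] => [//|i L'] _.
have : i \in [seq i <- iota 1 b | x \notin arrows (iter i delete_odd w)].
  by rewrite E mem_head.
rewrite mem_filter mem_iota add1n ltnS => /and3P[_ i1 ib].
by exists i, L'.
Qed.

Lemma flabel_finite m (w : word bool) x : x \in arrows w ->
  (exists2 j, flabel (Some m) w x = Some j.+1 & (j <= m)%N)
  /\ (flabel (Some m) w x == Some m.+1) = (x \in arrows (iter m delete_odd w)).
Proof.
move=> xw; have := flabel_head m xw; rewrite /flabel.
case: ifP => _ => [->|[[|i] [L' [// _ im ->]]]] /=.
  by rewrite eqxx; split=> //; exists m.
split; first by exists i; rewrite // ltnW.
by apply/eqP => -[E]; rewrite E ltnn in im.
Qed.

Lemma flabel_infinite (w : word bool) x : x \in arrows w ->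
  (flabel None w x == None) = (x \in arrows (iter (size (arrows w)) delete_odd w)).
Proof.
move=> xw; have := flabel_head (size (arrows w)) xw; rewrite /flabel.
by case: ifP => _ => [->|[i [L' [_ _ ->]]]].
Qed.

Lemma sum_coef_iter N m (w : word bool) (P : pred nat) :
  {in arrows w, P =1 mem (arrows (iter m delete_odd w))} ->
  \sum_(A <- subsets (arrows w) | all P A) term N (subdiagram (mem A) w)
  = coef N (iter m delete_odd w).
Proof.
move=> PE; rewrite subsets_filter /coef.
set v := iter m _ w; have vE : v = subdiagram (mem (arrows v)) w by apply: iter_subdiagram.
transitivity (\sum_(A <- subsets (arrows v)) term N (subdiagram (mem A) w)).
  apply: perm_subsets; first exact: set_function_term.
  apply: uniq_perm; rewrite ?filter_uniq ?uniq_arrows // => x; rewrite mem_filter.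
  apply/andP/idP => [[Px xw]|xv]; first by have := PE x xw; rewrite Px.
  have xw : x \in arrows w by apply: (@arrows_iter 0 m).
  by rewrite PE.
apply: eq_big_seq => A /subsets_sub Av; congr term.
rewrite [in RHS]vE subdiagram_comp; apply: eq_subdiagram_in => x _ /=.
by case xA: (x \in A) => //=; rewrite Av.
Qed.

(** Summing over the subdiagrams that survive all deletions, and over those that
    do not survive the first [m], expresses the invariant by unlabelled
    coefficients. *)
Lemma conway_coefE n m M (D : gauss_diagram) : (size (arrows D) <= M)%N ->
  conway_coef n m D
  = coef n.*2 (iter M delete_odd D)
    + (coef n.*2 D - coef n.*2 (iter m delete_odd D)).
Proof.
move=> /iter_delete_odd->; have gD := code_gauss D.
rewrite /conway_coef /Lambda pairing_even // pairing_odd //; last first.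
  by move=> x /(flabel_finite m)[].
rewrite (@sum_coef_iter _ (size (arrows D))); last exact: flabel_infinite.
congr (_ + _); rewrite -(@sum_coef_iter _ m _ (fun x => flabel (Some m) D x == Some m.+1)).
  by rewrite /coef [X in X - _](bigID (all (fun x => flabel (Some m) D x == Some m.+1))) /= [RHS]addrC addKr.
by move=> x /(flabel_finite m)[].
Qed.

Lemma equivalent_conway_coef n m (D E : gauss_diagram) :
  equivalent D E -> conway_coef n m D = conway_coef n m E.
Proof.
move=> DE; pose M := maxn (size (arrows D)) (size (arrows E)).
rewrite !(@conway_coefE n m M) ?leq_maxl ?leq_maxr //.
by rewrite !(fun k => equivalent_coef n.*2 k DE) (equivalent_coef n.*2 0 DE).
Qed.

(** * Diagrams with prescribed deletion of the odd arrows *)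

Lemma fresh_arrow (w : word bool) : exists n, n \notin arrows w.
Proof.
exists (sumn (arrows w)).+1; apply/negP => nw.
have le s x : x \in s -> (x <= sumn s)%N.
  by elim: s => //= y s IH; rewrite inE => /predU1P[->|/IH]; lia.
by have := le _ _ nw; rewrite ltnn.
Qed.

(** A new arrow around a single endpoint is linked with one arrow only. *)
Lemma surround (w : word bool) x : is_gauss w -> x \in arrows w ->
  exists n w', [/\ n \notin arrows w, is_gauss w', subdiagram (predC1 n) w' = w,
    even_arrow w' n = false
    & {in arrows w, forall y, even_arrow w' y = even_arrow w y (+) (y == x)}].
Proof.
move=> gw xw; have [n nw] := fresh_arrow w.
have [e ew xE] : exists2 e, e \in w & x = arrow e.
  by move: xw; rewrite mem_arrows => /mapP.
have [u [v wE]] := mem_split ew.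
pose N h : letter bool := (n, h, true).
have nN d : d \in w -> arrow d != n by move/arrows_mem => dw; apply: contraNneq nw => <-.
pose w' := u ++ [:: N false] ++ [:: e] ++ [:: N true] ++ v.
have pw : perm_eq w' ([:: N false; N true] ++ w).
  by apply/permP => a; rewrite /w' wE !count_cat /= ; lia.
have sub_w : subdiagram (predC1 n) w = w by apply/all_filterP/allP => d /nN.
exists n, w'; split=> //.
- rewrite (perm_gauss pw); have [uw mw iw] := gaussP _ gw; apply/gaussP; split.
  + have Nw h : N h \notin w by apply/negP => /nN; rewrite /arrow eqxx.
    by rewrite /= inE negb_or !Nw uw !andbT; apply/eqP => -[].
  + move=> d; rewrite mem_cat !inE -orbA => /or3P[/eqP->|/eqP->|/mw dw].
    * by rewrite -[mirror _]/(N true) eqxx ?orbT.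
    * by rewrite -[mirror _]/(N false) eqxx ?orbT.
    by rewrite dw ?orbT.
  + move=> d d'; rewrite !mem_cat !inE -!orbA => /or3P[/eqP->|/eqP->|dw] /or3P[/eqP->|/eqP->|dw'] //=;
      try by [left | right].
    * by move/esym => E; have := nN _ dw'; rewrite E eqxx.
    * by move/esym => E; have := nN _ dw'; rewrite E eqxx.
    * by move=> E; have := nN _ dw; rewrite E eqxx.
    * by move=> E; have := nN _ dw; rewrite E eqxx.
    exact: iw.
- rewrite -[RHS]sub_w wE /w' !subdiagram_cat /= /arrow /= eqxx /=.
  by case: ifP.
- rewrite /even_arrow /w' !map_cat !position_parity_cat /= {2 3}/arrow /= eqxx.
  have out t : {subset t <= w} -> n \notin map (@arrow bool) t.
    by move=> tw; apply/mapP => -[d /tw/nN/negP dn E]; case: dn; rewrite E.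
  rewrite !position_parity_notin ?out //; try by move=> d dt; rewrite wE mem_cat ?inE dt ?orbT.
  by rewrite (negbTE (nN e ew)) /=; case: (odd _).
move=> y yw; have yn : (n == y) = false by apply: contraNF nw => /eqP->.
rewrite xE /even_arrow /w' wE !map_cat !position_parity_cat /= yn (eq_sym y).
by case: (odd _); case: (arrow e == y);
  rewrite /= ?addbT ?addbF ?addFb ?addTb ?addbN ?addNb ?negbK.
Qed.

(** Surrounding all odd arrows makes them even, while the new arrows are odd. *)
Lemma delete_odd_surj (w : word bool) : is_gauss w ->
  exists2 w', is_gauss w' & delete_odd w' = w.
Proof.
move=> gw.
have [w' [gw' sw ew nw]] : exists w', [/\ is_gauss w', subdiagram (mem (arrows w)) w' = w,
    {in arrows w, forall y, even_arrow w' y = true}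
    & forall y, y \in arrows w' -> y \notin arrows w -> even_arrow w' y = false].
  have : {subset [seq x <- arrows w | ~~ even_arrow w x] <= arrows w}.
    by move=> x; rewrite mem_filter => /andP[].
  have : uniq [seq x <- arrows w | ~~ even_arrow w x] by rewrite filter_uniq ?uniq_arrows.
  set xs := filter _ _ => uxs xsw.
  suff [w' [gw' sw ew nw]] : exists w', [/\ is_gauss w', subdiagram (mem (arrows w)) w' = w,
      {in arrows w, forall y, even_arrow w' y = even_arrow w y (+) (y \in xs)}
      & forall y, y \in arrows w' -> y \notin arrows w -> even_arrow w' y = false].
    exists w'; split=> // y yw; rewrite ew // mem_filter yw andbT.
    by case: (even_arrow w y).
  elim: xs uxs xsw => [_ _|x xs IH /= /andP[xxs uxs] xsw].
    exists w; split=> //; first by apply/all_filterP/allP => e; apply: arrows_mem.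
      by move=> y _; rewrite addbF.
    by move=> y ->.
  have [|w1 [g1 s1 e1 n1]] := IH uxs; first by move=> y ys; apply: xsw; rewrite inE ys orbT.
  have sub1 : {subset arrows w <= arrows w1}.
    by move=> y; rewrite -{1}s1 mem_arrows_subdiagram => /andP[].
  have [n [w2 [nw g2 s2 en e2]]] := surround g1 (sub1 x (xsw x (mem_head _ _))).
  exists w2; split=> //.
  - rewrite -[RHS]s1 -s2 subdiagram_comp; apply: eq_subdiagram_in => y _ /=.
    by case yw: (y \in arrows w) => //=; apply/esym; apply: contraNneq nw => <-; apply: sub1.
  - move=> y yw; rewrite e2 ?sub1 // e1 // inE -addbA; congr (_ (+) _).
    by case: eqP => [->|_]; rewrite ?addbF // (negbTE xxs).
  move=> y y2 yw; have [->//|yn] := eqVneq y n.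
  have y1 : y \in arrows w1 by rewrite -s2 mem_arrows_subdiagram /= yn.
  rewrite e2 // n1 //; apply/negbTE; apply: contraNneq yw => ->.
  by apply: xsw; rewrite mem_head.
exists w' => //; rewrite delete_oddE // -[RHS]sw; apply: eq_subdiagram_in => y yw' /=.
by case: (boolP (y \in arrows w)) => [/ew|/(nw _ yw')].
Qed.

Lemma iter_delete_odd_surj m (w : word bool) : is_gauss w ->
  exists2 w', is_gauss w' & iter m delete_odd w' = w.
Proof.
elim: m w => [|m IH] w gw; first by exists w.
have [v gv <-] := delete_odd_surj gw; have [w' gw' <-] := IH v gv.
by exists w'.
Qed.

(** * A Conway diagram without even arrows *)

(** Two linked arrows that form a Conway diagram. *)
Definition clasp (i : nat) : word bool :=
  [:: (i.*2, false, true); (i.*2.+1, true, true);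
      (i.*2, true, true); (i.*2.+1, false, true)].

Definition clasp_tour (i : nat) : word bool :=
  [:: (i.*2, false, true); (i.*2.+1, false, true);
      (i.*2, true, true); (i.*2.+1, true, true)].

Definition clasps (k : nat) : word bool := flatten (map clasp (iota 0 k)).

Lemma clasps_rcons (f : nat -> word bool) k :
  flatten (map f (iota 0 k.+1)) = flatten (map f (iota 0 k)) ++ f k.
Proof. by rewrite -addn1 iotaD map_cat flatten_cat /= cats0. Qed.

Lemma size_clasps k : size (clasps k) = (k.*2.*2)%N.
Proof.
by elim: k => // k IH; rewrite /clasps clasps_rcons size_cat -/(clasps k) IH !doubleS addn4.
Qed.

Lemma perm_clasps k : perm_eq (flatten (map clasp_tour (iota 0 k))) (clasps k).
Proof.
rewrite /clasps; elim: (iota 0 k) => // i s IH; apply: perm_cat => //.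
by apply/permP => a; rewrite /= [RHS]addnC -!addnA; lia.
Qed.

Lemma clasps_arrow k : {in clasps k, forall e, (arrow e < k.*2)%N}.
Proof.
move=> e /flattenP[_ /mapP[i + ->]]; rewrite mem_iota /= => ik.
by rewrite !inE => /or4P[]/eqP->; rewrite /arrow /=; lia.
Qed.

Lemma gauss_cat (T : eqType) (u v : word T) : is_gauss u -> is_gauss v ->
  {in u & v, forall d e, arrow d != arrow e} -> is_gauss (u ++ v).
Proof.
move=> /gaussP[uu mu iu] /gaussP[uv mv iv] dis; apply/gaussP; split.
- rewrite cat_uniq uu uv andbT /=; apply/hasPn => e ev; apply/negP => eu.
  by have := dis e e eu ev; rewrite eqxx.
- by move=> e; rewrite !mem_cat => /orP[/mu->|/mv->]; rewrite ?orbT.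
move=> d e; rewrite !mem_cat => /orP[du|dv] /orP[eu|ev].
- exact: iu.
- by move=> E; have := dis d e du ev; rewrite E eqxx.
- by move=> E; have := dis e d eu dv; rewrite E eqxx.
exact: iv.
Qed.

Lemma gauss_clasps k : is_gauss (clasps k).
Proof.
elim: k => // k IH; rewrite /clasps clasps_rcons; apply: gauss_cat => //.
  rewrite /is_gauss /mirror /arrow /is_head /deco /= !inE !eqxx !orbT.
  by rewrite (ltn_eqF (ltnSn _)) (gtn_eqF (ltnSn _)).
by move=> d e /clasps_arrow dk; rewrite !inE => /or4P[]/eqP->; rewrite /arrow /= in dk *; lia.
Qed.

(** In each clasp the four endpoints alternate, and it starts at an even position. *)
Lemma delete_odd_clasps k : delete_odd (clasps k) = [::].
Proof.
rewrite delete_oddE ?gauss_clasps //; apply/eqP; rewrite -[_ == _]negbK -has_filter.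
apply/hasPn => e _ /=; apply/negbT; move: (arrow e) => x; rewrite /even_arrow.
elim: k => // k IH; rewrite /clasps clasps_rcons map_cat position_parity_cat.
rewrite IH size_map -/(clasps k) size_clasps odd_double /arrow /=.
by do 2!case: (_ == x).
Qed.

Lemma trail_id (X : eqType) (l r : seq X) :
  uniq (l ++ r) -> trail id (l ++ r) (ohead r) r.
Proof.
elim: r l => [|x r IH] l // ur; apply/andP; split; first by rewrite eqxx.
rewrite (after_split (mu := id) ur (l := l) (r := r)) // -cat_rcons.
by apply: IH; rewrite cat_rcons.
Qed.

(** The traveller runs through one clasp after the other. *)
Lemma conway_clasps k : conway (clasps k).
Proof.
have uk := iota_uniq 0 k.
apply: (proj2 (conway_subst (mu := id) (B := clasp) (I := clasp_tour) uk (gauss_clasps k) _ (perm_clasps k))).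
  move=> i ik; split=> //; exists (i.*2, false, true), (behead (clasp_tour i)), (behead (clasp i)).
  split=> //=; split; [|split; [|split]].
  - by exists i, [:: (i.*2, false, true); (i.*2.+1, true, true)], [::].
  - by exists i, [:: (i.*2, false, true)], [:: (i.*2.+1, false, true)].
  - by exists i, [::], [:: (i.*2, true, true); (i.*2.+1, false, true)].
  by exists [:: (i.*2, false, true); (i.*2.+1, true, true); (i.*2, true, true)].
exists (iota 0 k).
  rewrite /tour perm_refl andbT; have := @trail_id _ [::] (iota 0 k) uk.
  by case: k {uk}.
elim: k {uk} => // k IH; rewrite clasps_rcons (ascends_split (fun x => x < k.*2)%N).
have small : {in flatten (map clasp_tour (iota 0 k)), forall e, (arrow e < k.*2)%N}.
  by move=> e; rewrite (perm_mem (perm_clasps k)); apply: clasps_arrow.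
rewrite !filter_cat.
have -> : [seq e <- clasp_tour k | (arrow e < k.*2)%N] = [::].
  by rewrite /= /arrow /= !ifN //; lia.
have -> : [seq e <- clasp_tour k | ~~ (arrow e < k.*2)%N] = clasp_tour k.
  by rewrite /= /arrow /= !ifT //; lia.
rewrite cats0; have /all_filterP-> : all (fun e : letter bool => (arrow e < k.*2)%N)
  (flatten (map clasp_tour (iota 0 k))) by apply/allP.
rewrite IH; have -> : [seq e <- flatten (map clasp_tour (iota 0 k)) | ~~ (arrow e < k.*2)%N] = [::].
  apply/eqP; rewrite -[_ == _]negbK -has_filter; apply/hasPn => e /small.
  by rewrite negbK.
rewrite /ascends /= /mirror /arrow /is_head /deco /= !eqxx.
by rewrite (ltn_eqF (ltnSn _)) (gtn_eqF (ltnSn _)) /= !eqxx.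
Qed.

Lemma size_subsets s A : A \in subsets s -> (size A <= size s)%N.
Proof.
elim: s A => [|x s IH] A /=; first by rewrite inE => /eqP->.
by rewrite mem_cat => /orP[/IH/leqW|/mapP[A' /IH + ->]].
Qed.

Lemma sum_subsets_full s (F : seq nat -> int) :
  {in subsets s, forall A, (size A < size s)%N -> F A = 0} ->
  \sum_(A <- subsets s) F A = F s.
Proof.
elim: s F => [|x s IH] F F0; first by rewrite big_seq1.
rewrite big_subsets_cons big1_seq ?add0r.
  apply: (IH (F \o cons x)) => A As ltA; apply: F0 => //=.
  by rewrite mem_cat map_f ?orbT.
move=> A /andP[_ As]; apply: F0; first by rewrite /= mem_cat As.
by rewrite ltnS size_subsets.
Qed.

(** A proper subdiagram has fewer than [N] arrows. *)
Lemma coef_full N (w : word bool) : is_gauss w -> size w = N.*2 -> conway w ->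
  coef N w = weight w.
Proof.
move=> gw sw cw; rewrite /coef sum_subsets_full.
  have -> : subdiagram (mem (arrows w)) w = w.
    by apply/all_filterP/allP => e; apply: arrows_mem.
  by rewrite /term sw eqxx cw.
move=> A _ ltA; rewrite /term ifN // negb_and; apply/orP; left.
rewrite size_gauss ?gauss_subdiagram // (inj_eq double_inj) ltn_eqF //.
apply: leq_ltn_trans (_ : size A < N)%N; last first.
  by have := size_gauss gw; rewrite sw => /double_inj ->.
apply: uniq_leq_size; first exact: uniq_arrows.
by move=> x; rewrite mem_arrows_subdiagram => /andP[].
Qed.

Lemma weight_clasps k : weight (clasps k) = 1.
Proof.
rewrite /weight big1_seq // => e /andP[_ /flattenP[_ /mapP[i _ ->]]].
by rewrite !inE => /or4P[]/eqP->.
Qed.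

Lemma coef_nil N : (0 < N)%N -> coef N [::] = 0.
Proof. by rewrite /coef /= big_seq1 /term; case: N. Qed.

(** A diagram whose [m1]-th deletion is a chain of clasps becomes empty at the next
    deletion. *)
Lemma separating_diagram k m1 m2 : (1 <= k)%N -> (m1 < m2)%N ->
  exists D : gauss_diagram, conway_coef k m1 D <> conway_coef k m2 D.
Proof.
move=> k1 m12; have [w gw wE] := iter_delete_odd_surj m1 (gauss_clasps k).
exists (GaussDiagram gw); rewrite !(@conway_coefE _ _ (size (arrows w))) //=.
move/addrI/addrI/oppr_inj; rewrite wE coef_full ?gauss_clasps ?size_clasps ?conway_clasps //.
have -> : iter m2 delete_odd w = [::].
  have -> : m2 = ((m2 - m1.+1) + m1.+1)%N by lia.
  rewrite iterD iterS wE delete_odd_clasps; elim: (m2 - _)%N => //= j ->.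
  by [].
by rewrite weight_clasps coef_nil ?double_gt0.
Qed.

Lemma separating_knot k m1 m2 : (1 <= k)%N -> (m1 < m2)%N ->
  exists K : long_virtual_knot, forall D1 D2 : gauss_diagram, K D1 -> K D2 ->
    conway_coef k m1 D1 <> conway_coef k m2 D2.
Proof.
move=> k1 /(separating_diagram k1)[D neqD].
have cl : exists D0, forall E, equivalent D E <-> equivalent D0 E by exists D.
exists (LongVirtualKnot cl) => D1 D2 /= e1 e2.
by rewrite -(equivalent_conway_coef _ _ e1) -(equivalent_conway_coef _ _ e2).
Qed.

(* D1 and D2 are arbitrary Gauss diagrams of K, so that the claim compares the
   values of the two invariants on K itself. *)
Theorem mainTheorem8 (k m1 m2 : nat) :
  (1 <= k)%N -> m1 <> m2 ->
  exists K : long_virtual_knot,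
    forall D1 D2 : gauss_diagram, K D1 -> K D2 ->
      conway_coef k m1 D1 <> conway_coef k m2 D2
      /\ nabla m1 D1 <> nabla m2 D2.
Proof.
move=> k1 m12; suff [K neqK] : exists K : long_virtual_knot,
    forall D1 D2 : gauss_diagram, K D1 -> K D2 ->
    conway_coef k m1 D1 <> conway_coef k m2 D2.
  exists K => D1 D2 K1 K2; split; first exact: neqK.
  move/(congr1 (fun p : {poly int} => p`_(k.*2))); rewrite !coef_nabla.
  exact: neqK.
have [lt12|lt21|//] := ltngtP m1 m2; first exact: separating_knot.
have [K neqK] := separating_knot k1 lt21.
by exists K => D1 D2 K1 K2 /esym; apply: neqK.
Qed.
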